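(* There exists an absolute constant $\varepsilon_0>0$ such that for every $k\geq 1$ there exists $n=n(k)$ and a reference distribution $\mathbf{q}$ over $[k]$ such that any algorithm solving $\mathrm{BinIdentity}(n,\mathbf{q},k,\varepsilon_0)$ must use at least $k/2^{O(\sqrt{\log k})}$ samples.
   Context: $\log$ denotes the binary logarithm. For integers $n,k\geq 1$, let $\mathcal{J}_{n,k}$ denote the set of all ordered partitions $(I_1,\dots,I_k)$ of $[n]$ into $k$ pairwise disjoint consecutive intervals (listed in increasing order), each possibly empty. Given a distribution $\mathbf{q}$ over $[k]$, let $\mathcal{P}_{\mathbf{q}}$ be the set of distributions $\mathbf{p}'$ over $[n]$ for which there exists $(I_1,\dots,I_k)\in\mathcal{J}_{n,k}$ with $\mathbf{p}'(I_j)=\mathbf{q}(j)$ for all $j$. Let $d_{TV}(\mathbf{p},\mathcal{P}_{\mathbf{q}})=\min_{\mathbf{p}'\in\mathcal{P}_{\mathbf{q}}}\frac12\sum_i|\mathbf{p}(i)-\mathbf{p}'(i)|$. The problem $\mathrm{BinIdentity}(n,\mathbf{q},k,\varepsilon)$: given i.i.d. samples from an unknown distribution $\mathbf{p}$ over $[n]$, accept with probability at least $2/3$ if $\mathbf{p}\in\mathcal{P}_{\mathbf{q}}$ and reject with probability at least $2/3$ if $d_{TV}(\mathbf{p},\mathcal{P}_{\mathbf{q}})>\varepsilon$. *)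

(* Defs.v *)
From Stdlib Require Import Reals.
From mathcomp Require Import all_boot all_order all_algebra.
From mathcomp Require Import Rstruct.
Set Implicit Arguments. Unset Strict Implicit. Unset Printing Implicit Defensive.
Import Order.TTheory GRing.Theory Num.Theory.
Local Open Scope ring_scope.

Definition is_dist (n : nat) (p : 'I_n -> R) : Prop :=
  (forall i, 0 <= p i) /\ \sum_(i < n) p i = 1.

(* Ordered partitions of [n] into k consecutive (possibly empty) intervals
   I_1,...,I_k, listed in increasing order, are encoded by boundaries
   0 = b 0 <= b 1 <= ... <= b k = n, with I_(j+1) = [b j, b (j+1)). *)
Definition interval_partition (n k : nat) (b : nat -> nat) : Prop :=
  b 0%N = 0%N /\ b k = n /\ (forall j, (j < k)%N -> (b j <= b j.+1)%N).

Definition in_Pq (n k : nat) (q : 'I_k -> R) (p' : 'I_n -> R) : Prop :=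
  is_dist p' /\
  exists b : nat -> nat, interval_partition n k b /\
    forall j : 'I_k, \sum_(i < n | (b j <= i < b j.+1)%N) p' i = q j.

Definition dTV (n : nat) (p p' : 'I_n -> R) : R :=
  2^-1 * \sum_(i < n) `|p i - p' i|.

(* d_TV(p, P_q) > eps. The minimum defining d_TV(p,P_q) is attained
   (P_q is a finite union of compact sets), so this is equivalent to
   every p' in P_q being at distance > eps from p. *)
Definition far_from_Pq (n k : nat) (q : 'I_k -> R) (eps : R) (p : 'I_n -> R) : Prop :=
  forall p' : 'I_n -> R, in_Pq q p' -> eps < dTV p p'.

(* A (possibly randomized) tester drawing m samples: for each sample
   sequence x it accepts with probability T x in [0,1]. *)
Definition acc_prob (n m : nat) (p : 'I_n -> R) (T : m.-tuple 'I_n -> R) : R :=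
  \sum_(x : m.-tuple 'I_n) (\prod_(i < m) p (tnth x i)) * T x.

Definition solves_BinIdentity (n k : nat) (q : 'I_k -> R) (eps : R) (m : nat)
    (T : m.-tuple 'I_n -> R) : Prop :=
  (forall x, 0 <= T x <= 1) /\
  forall p : 'I_n -> R, is_dist p ->
    (in_Pq q p -> 2%:R / 3%:R <= acc_prob p T) /\
    (far_from_Pq q eps p -> acc_prob p T <= 1 / 3%:R).

Definition log2 (x : R) : R := Rdiv (ln x) (ln 2%R).

(* Main.v *)
(** Labels matter only through their order: by Ramsey's theorem for m-subsets,
    on a large set of labels any m-sample tester is within 1/100 of a function
    of the order type of its sample.

    Split [n] into B blocks of mass 1/B, and a block into D units. In q a block
    consists of D - s bins of one unit and one bin of s units, s <= D/16. A block
    of p is filled with some atoms of one unit followed by atoms of width y. For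
    an order-invariant tester, the contribution of c samples falling in a block
    with h units of atoms of width y is a polynomial of degree at most c in h,
    and, at h = D, also in y. Hence, if at most r samples fall in each block, two
    laws of the block filling with matching combinations of such polynomials
    are indistinguishable. Divided differences at the widths 1, 2, X, 2X, ...,
    2^(r-1) X for h = D, combined with Lagrange extrapolation in h from [0, s] to D to
    replace the filling by wide atoms, give a signed measure on fillings
    annihilating these polynomials. All its positive atoms are compatible with
    q, and for X = 2^(20 r) its negative part is concentrated, up to 1/100, on the
    filling by atoms of two units, which is far from q because an atom of p'
    exceeding one unit has to lie in a large bin.

    With 2^(r^2) <= k < 2^((r+1)^2) we have D = 2^O(r), and no block receives more than
    r samples as long as m^(r+1) is much smaller than B^r. *)

Require Import Defs.
From Stdlib Require Import Reals.
From mathcomp Require Import all_boot all_order all_algebra.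
From mathcomp Require Import Rstruct ring lra zify.
Set Implicit Arguments. Unset Strict Implicit. Unset Printing Implicit Defensive.
Import Order.TTheory GRing.Theory Num.Theory.
Local Open Scope ring_scope.

(** * Ramsey's theorem *)

(** The Erdos-Rado condition: the colour of an (M+1)-subsequence of the listed points depends only
    on its first point, next to which it is recorded. *)
Fixpoint end_homogeneous (C : finType) (M : nat) (f : seq nat -> C)
    (ac : seq (nat * C)) : Prop :=
  if ac is (x, c) :: ac' then
    (forall e, subseq e (unzip1 ac') -> size e = M -> f (x :: e) = c) /\
    end_homogeneous M f ac'
  else True.

Lemma end_homogeneous_filter (C : finType) (M : nat) (f : seq nat -> C) ac c :
  end_homogeneous M f ac ->
  forall e, subseq e (unzip1 [seq p <- ac | p.2 == c]) -> size e = M.+1 -> f e = c.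
Proof.
elim: ac => [|[x d] ac IH] /=; first by move=> _ [|y e].
case=> Hx /IH{}IH e; case: eqP => [Ed|_]; last exact: IH.
case: e => // y e /=; case: eqP => [->|_] He; last first.
  by move=> se; apply: IH => /=.
case=> se; rewrite -Ed; apply: Hx => //.
apply: subseq_trans He _; apply: map_subseq; exact: filter_subseq.
Qed.

Lemma pigeonhole_count (C : finType) (T : eqType) (col : T -> C) (s : seq T) (t : nat) :
  (0 < #|C|)%N -> (t * #|C| <= size s)%N ->
  exists c, (t <= count (fun p => col p == c) s)%N.
Proof.
move=> C0 hs; apply/existsP; apply: contraT => /existsPn hn.
case: t hs hn => [|t] hs hn.
  by case/card_gt0P: C0 => c _; have := hn c; rewrite leq0n.
have : (\sum_c count (fun p => col p == c) s <= \sum_(c : C) t)%N.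
  by apply: leq_sum => c _; have := hn c; rewrite -ltnNge ltnS.
rewrite sum_nat_const.
have -> : (\sum_c count (fun p => col p == c) s = size s)%N.
  elim: s {hs hn} => [|x s IH] /=; first by rewrite big1.
  rewrite big_split /= IH (bigD1 (col x)) //= eqxx big1 ?addn0 ?add1n //.
  by move=> c; rewrite eq_sym => /negbTE->.
move: hs C0; rewrite [#|C|%N]lock; nia.
Qed.

(** Sets are subsequences of an arbitrary list, so that the induction on M applies to the tail of a
    list with the colouring e -> f (x :: e). *)
Lemma ramsey (C : finType) (M t : nat) :
  exists N, forall s : seq nat, (N <= size s)%N -> forall f : seq nat -> C,
    exists (s' : seq nat) (c : C), [/\ subseq s' s, size s' = t &
      forall e, subseq e s' -> size e = M -> f e = c].
Proof.
elim: M t => [|M IHM] t.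
  exists t => s hs f; exists (take t s), (f [::]); split; first exact: take_subseq.
    by rewrite size_takel.
  by move=> [|].
(* Greedy construction: the head x is kept, and the tail is thinned by the induction on M until the
   colour of x :: e no longer depends on e. *)
have EH j : exists N, forall s : seq nat, (N <= size s)%N -> forall f : seq nat -> C,
    exists ac, [/\ subseq (unzip1 ac) s, size ac = j & end_homogeneous M f ac].
  elim: j => [|j [Nj IHj]]; first by exists 0%N => s _ f; exists [::]; rewrite sub0seq.
  have [N' HN'] := IHM Nj.
  exists N'.+1 => -[//|x s] hs f.
  have [s1 [c [ss1 sz1 h1]]] := HN' s hs (fun e => f (x :: e)).
  have [|ac [sac szac hac]] := IHj s1 _ f; first by rewrite sz1.
  exists ((x, c) :: ac); split => /=.
  - by rewrite eqxx; apply: subseq_trans sac ss1.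
  - by rewrite szac.
  - by split=> // e he; apply: h1; apply: subseq_trans he sac.
(* Among t times [#|C|] points, some recorded colour occurs t times. *)
have [N HN] := EH (t * #|C|)%N.
exists N => s hs f.
have C0 : (0 < #|C|)%N by apply/card_gt0P; exists (f [::]).
have [ac [sac szac hac]] := HN s hs f.
have [|c hc] := @pigeonhole_count C _ (fun p : nat * C => p.2) ac t C0.
  by rewrite szac.
exists (take t (unzip1 [seq p <- ac | p.2 == c])), c; split.
- apply: subseq_trans (take_subseq _ _) _.
  apply: subseq_trans sac; apply: map_subseq; exact: filter_subseq.
- by rewrite size_takel // size_map size_filter.
- move=> e he; apply: (end_homogeneous_filter hac).
  exact: subseq_trans he (take_subseq _ _).
Qed.

(** * Order-invariant testers *)

Definition order_invariant (m : nat) (F : ('I_m -> nat) -> R) : Prop :=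
  forall w w' : 'I_m -> nat,
    (forall i j, (w i <= w j)%N = (w' i <= w' j)%N) -> F w = F w'.

(** The ranks are a canonical form of the order type of w, ties included; being less than m, they
    leave only finitely many order types. *)
Definition value_rank (m : nat) (w : 'I_m -> nat) (i : 'I_m) : nat :=
  size (undup [seq w j | j <- enum 'I_m & (w j < w i)%N]).

Lemma value_rank_lt (m : nat) (w : 'I_m -> nat) i : (value_rank w i < m)%N.
Proof.
apply: leq_ltn_trans (size_undup _) _; rewrite size_map size_filter.
have := count_predC (fun j => (w j < w i)%N) (enum 'I_m).
rewrite size_enum_ord => E; rewrite -[X in (_ < X)%N]E -[X in (X < _)%N]addn0.
rewrite ltn_add2l -has_count; apply/hasP; exists i; first by rewrite mem_enum.
by rewrite /= ltnn.
Qed.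

Lemma size_undup_map (I : eqType) (w w' : I -> nat) (s : seq I) :
  (forall i j, (w i == w j) = (w' i == w' j)) ->
  size (undup [seq w j | j <- s]) = size (undup [seq w' j | j <- s]).
Proof.
move=> E; elim: s => //= x s IH.
have -> : (w x \in [seq w j | j <- s]) = (w' x \in [seq w' j | j <- s]).
  by apply/mapP/mapP => -[y ys /eqP e]; exists y => //; apply/eqP; rewrite ?E // -E.
by case: ifP => _ //=; rewrite IH.
Qed.

Lemma value_rank_inv (m : nat) (w w' : 'I_m -> nat) :
  (forall i j, (w i <= w j)%N = (w' i <= w' j)%N) -> value_rank w =1 value_rank w'.
Proof.
move=> E i; rewrite /value_rank.
have -> : [seq j <- enum 'I_m | (w j < w i)%N] = [seq j <- enum 'I_m | (w' j < w' i)%N].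
  by apply: eq_filter => j; rewrite !ltnNge E.
by apply: size_undup_map => j k; rewrite !eqn_leq !E.
Qed.

Lemma index_value_rank (m P : nat) (w : 'I_m -> nat) i :
  (forall i, (w i < P)%N) ->
  index (w i) [seq v <- iota 0 P | v \in [seq w j | j <- enum 'I_m]] = value_rank w i.
Proof.
move=> hw; set im := [seq w j | j <- _].
have wi : w i \in im by apply: map_f; rewrite mem_enum.
have -> : iota 0 P = iota 0 (w i) ++ w i :: iota (w i).+1 (P - (w i).+1).
  rewrite -[w i :: _]/(iota (w i) (P - (w i).+1).+1) -[X in iota X (_.+1)]add0n -iotaD.
  by rewrite subnSK // subnKC // ltnW.
rewrite filter_cat /= wi index_cat mem_filter mem_iota ltnn !andbF /= eqxx addn0.
apply: perm_size; apply: uniq_perm; rewrite ?filter_uniq ?iota_uniq ?undup_uniq //.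
move=> v; rewrite mem_undup mem_filter mem_iota /= add0n.
apply/andP/mapP => [[/mapP[j _ ->] lt]|[j]].
  by exists j => //; rewrite mem_filter lt mem_enum.
by rewrite mem_filter => /andP[lt _] ->; split=> //; apply: map_f; rewrite mem_enum.
Qed.

Lemma nat_grid (K : nat) (v : R) : 0 <= v <= K%:R ->
  exists2 c, (c <= K)%N & c%:R <= v <= c%:R + 1.
Proof.
elim: K => [|K IH] /andP[v0 vK]; first by exists 0%N => //; rewrite mulr0n v0 add0r; apply: le_trans vK _.
have [le|lt] := lerP v K%:R; first by case: IH => [|c cK hc]; [rewrite v0 | exists c => //; exact: leqW].
by exists K => //; rewrite (ltW lt) natr1.
Qed.

Lemma unit_grid (K : nat) (v : R) : 0 <= v <= 1 ->
  exists c : 'I_K.+2, `|v - c%:R / K.+1%:R| <= K.+1%:R^-1.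
Proof.
move=> /andP[v0 v1].
have K0 : 0 < K.+1%:R :> R by rewrite ltr0n.
have [|c cK /andP[h1 h2]] := @nat_grid K.+1 (v * K.+1%:R).
  by rewrite mulr_ge0 ?(ltW K0) //= ler_piMl // ltW.
exists (Ordinal (cK : c < K.+2)%N) => /=.
have -> : v - c%:R / K.+1%:R = (v * K.+1%:R - c%:R) / K.+1%:R.
  by rewrite mulrBl mulfK // gt_eqF.
rewrite normrM [`|_^-1|]gtr0_norm ?invr_gt0 // ler_piMl ?invr_ge0 ?(ltW K0) //.
rewrite ger0_norm ?subr_ge0 // lerBlDl; exact: h2.
Qed.

(** The colour of an m-subset of labels lists, for every rank pattern o, the rounded acceptance
    probability of the sample with the o(i)-th label of the subset at position i. On a homogeneous
    set it depends on o alone, which defines F. *)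
Lemma order_invariant_tester (m P K : nat) :
  exists N, forall n, (N <= n)%N -> forall T : m.-tuple 'I_n.+1 -> R,
    (forall x, 0 <= T x <= 1) ->
    exists (z : nat -> 'I_n.+1) (F : ('I_m -> nat) -> R),
      [/\ forall a b, (a < b < P)%N -> (z a < z b)%N,
          forall w, 0 <= F w <= 1,
          order_invariant F &
          forall w : 'I_m -> nat, (forall i, (w i < P)%N) ->
            `|T [tuple z (w i) | i < m] - F w| <= K.+1%:R^-1].
Proof.
(* The first P points of the homogeneous set become the labels z; the m others complete samples with
   fewer than m distinct labels to m-subsets. *)
have [N HN] := ramsey {ffun {ffun 'I_m -> 'I_m} -> 'I_K.+2} m (P + m).
exists N => n hn T hT.
pose grid (v : R) : 'I_K.+2 :=
  odflt ord0 [pick c : 'I_K.+2 | `|v - c%:R / K.+1%:R| <= K.+1%:R^-1].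
have gridP v : 0 <= v <= 1 -> `|v - (grid v)%:R / K.+1%:R| <= K.+1%:R^-1.
  move=> /(unit_grid K)[c hc]; rewrite /grid; case: pickP => // /(_ c).
  by rewrite hc.
pose f (e : seq nat) := [ffun o : {ffun 'I_m -> 'I_m} =>
  grid (T [tuple inord (nth 0%N e (o i)) | i < m])].
have [|Z [c0 [sZ szZ hZ]]] := HN (iota 0 n.+1) _ f.
  by rewrite size_iota; apply: leq_trans hn _.
have Zn a : (a < P + m)%N -> (nth 0%N Z a < n.+1)%N.
  move=> ha; have : nth 0%N Z a \in Z by rewrite mem_nth // szZ.
  by move=> /(mem_subseq sZ); rewrite mem_iota.
have sortZ : sorted ltn Z by apply: subseq_sorted sZ (iota_ltn_sorted _ _); exact: ltn_trans.
pose z a : 'I_n.+1 := inord (nth 0%N Z a).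
pose rk (w : 'I_m -> nat) := [ffun i => Ordinal (value_rank_lt w i)].
exists z, (fun w => (c0 (rk w))%:R / K.+1%:R); split.
- move=> a b /andP[ab bP]; rewrite !inordK ?Zn //; try lia.
  by apply: (sorted_ltn_nth ltn_trans 0%N sortZ) => //; rewrite inE szZ; lia.
- move=> w; rewrite divr_ge0 ?ler0n //= ler_pdivrMr ?ltr0n // mul1r ler_nat.
  by rewrite -ltnS.
- move=> w w' E; congr ((c0 _)%:R / _); apply/ffunP => i; rewrite !ffunE.
  by apply: val_inj; apply: value_rank_inv.
move=> w hw.
pose V := [seq v <- iota 0 P | v \in [seq w j | j <- enum 'I_m]].
(* The distinct values of w come first, in increasing order, so the entry of [e] at index
   [value_rank w i] is the label of w i; the rest is padding. *)
pose e := [seq nth 0%N Z v | v <- V ++ iota P (m - size V)].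
have szV : (size V <= m)%N.
  rewrite -[X in (_ <= X)%N](size_enum_ord m) -(size_map w); apply: uniq_leq_size.
    by rewrite filter_uniq ?iota_uniq.
  by move=> v; rewrite mem_filter => /andP[].
have sze : size e = m by rewrite size_map size_cat size_iota subnKC.
have sube : subseq e Z.
  rewrite -[X in subseq _ X](mkseq_nth 0%N) szZ; apply: map_subseq.
  rewrite iotaD; apply: cat_subseq; first exact: filter_subseq.
  by rewrite add0n -[X in subseq _ (iota _ X)](subnK szV) iotaD prefix_subseq.
have := hZ e sube sze => /ffunP /(_ (rk w)); rewrite ffunE => <-.
have -> : [tuple inord (nth 0%N e (rk w i)) | i < m] = [tuple z (w i) | i < m].
  apply: eq_from_tnth => i; rewrite !tnth_mktuple ffunE /= -(index_value_rank _ hw) -/V.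
  have wV : w i \in V.
    by rewrite mem_filter mem_iota leq0n add0n hw !andbT; apply: map_f; rewrite mem_enum.
  have iV : (index (w i) V < size V)%N by rewrite index_mem.
  rewrite (nth_map 0%N) ?size_cat; last by apply: leq_trans iV _; exact: leq_addr.
  by rewrite nth_cat iV nth_index.
exact: gridP.
Qed.

(** * Counting samples by order type *)

(** The increasing bijection from A to A' when they have the same size; the default of [nth] is then
    not reached for x in A. *)
Definition rank_transfer (D : nat) (A A' : {set 'I_D}) (x : 'I_D) : 'I_D :=
  nth x (enum A') (index x (enum A)).

Lemma rank_transfer_in (D : nat) (A A' : {set 'I_D}) x :
  #|A| = #|A'| -> x \in A -> rank_transfer A A' x \in A'.
Proof.
by move=> E xA; rewrite -mem_enum mem_nth // -cardE -E cardE index_mem mem_enum.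
Qed.

Lemma index_rank_transfer (D : nat) (A A' : {set 'I_D}) x :
  #|A| = #|A'| -> x \in A -> index (rank_transfer A A' x) (enum A') = index x (enum A).
Proof.
move=> E xA; rewrite index_uniq ?enum_uniq //.
by rewrite -cardE -E cardE index_mem mem_enum.
Qed.

Lemma rank_transferK (D : nat) (A A' : {set 'I_D}) x :
  #|A| = #|A'| -> x \in A -> rank_transfer A' A (rank_transfer A A' x) = x.
Proof.
move=> E xA; rewrite {1}/rank_transfer index_rank_transfer //.
by rewrite nth_index // mem_enum.
Qed.

Lemma leq_index_enum (D : nat) (A : {set 'I_D}) x y :
  x \in A -> y \in A -> (index x (enum A) <= index y (enum A))%N = (x <= y)%N.
Proof.
move=> xA yA.
have sA : sorted (fun a b : 'I_D => (a < b)%N) (enum A).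
  have : sorted ltn (map val (enum 'I_D)) by rewrite val_enum_ord iota_ltn_sorted.
  rewrite sorted_map => sD; rewrite {1}/enum_mem -enumT; apply: sorted_filter sD => a b c.
  exact: ltn_trans.
have tr : transitive (fun a b : 'I_D => (a < b)%N) by move=> a b c; exact: ltn_trans.
have H := sorted_ltn_index tr sA.
apply/idP/idP => [|le].
  rewrite leq_eqVlt => /predU1P[e|/H h].
    suff -> : x = y by [].
    by rewrite -(@nth_index _ x x (enum A)) ?mem_enum // e nth_index ?mem_enum.
  by apply: ltnW; apply: h; rewrite mem_enum.
rewrite leqNgt; apply/negP => /H h; have := h; rewrite !mem_enum => /(_ yA xA).
by rewrite ltnNge le.
Qed.

Lemma leq_rank_transfer (D : nat) (A A' : {set 'I_D}) x y :
  #|A| = #|A'| -> x \in A -> y \in A ->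
  (rank_transfer A A' x <= rank_transfer A A' y)%N = (x <= y)%N.
Proof.
move=> E xA yA; rewrite -(leq_index_enum (A := A')) ?rank_transfer_in //.
by rewrite !index_rank_transfer // leq_index_enum.
Qed.

(* Group the assignments t by the sets of values they take in each zone. The
   monotone bijections between sets of equal size carry one group to the other,
   so the sum over a group depends only on the sizes l of its sets. *)
Lemma zone_count (I Z : finType) (D : nat) (alpha : I -> Z) (G : {ffun I -> 'I_D} -> R) :
  (forall t t' : {ffun I -> 'I_D},
     (forall i j, alpha i = alpha j -> (t i <= t j)%N = (t' i <= t' j)%N) -> G t = G t') ->
  exists kappa : {ffun Z -> 'I_D.+1} -> R,
    (forall l v, kappa l != 0 -> (l v <= #|[set i | alpha i == v]|)%N) /\
    forall n : Z -> nat, (forall v, (n v <= D)%N) ->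
      \sum_(t : {ffun I -> 'I_D} | [forall i, (t i < n (alpha i))%N]) G t =
      \sum_l kappa l * \prod_v ('C(n v, l v))%:R.
Proof.
move=> Ginv.
pose im (t : {ffun I -> 'I_D}) : {ffun Z -> {set 'I_D}} :=
  [ffun v => [set t i | i in [set i | alpha i == v]]].
have im_in (t : {ffun I -> 'I_D}) i : t i \in im t (alpha i) by rewrite ffunE; apply: imset_f; rewrite inE.
pose g s := \sum_(t | im t == s) G t.
have gE (s s' : {ffun Z -> {set 'I_D}}) : (forall v, #|s v| = #|s' v|) -> g s = g s'.
  move=> Ess.
  pose h (a b : {ffun Z -> {set 'I_D}}) (t : {ffun I -> 'I_D}) : {ffun I -> 'I_D} :=
    [ffun i => rank_transfer (a (alpha i)) (b (alpha i)) (t i)].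
  have him (a b : {ffun Z -> {set 'I_D}}) (t : {ffun I -> 'I_D}) :
      (forall v, #|a v| = #|b v|) -> im t = a -> im (h a b t) = b.
    move=> Eab ea; have ti i : t i \in a (alpha i) by rewrite -ea.
    apply/ffunP => v; rewrite ffunE; apply/setP => x.
    apply/imsetP/idP => [[i]|xb].
      by rewrite inE => /eqP <- ->; rewrite ffunE rank_transfer_in.
    have := rank_transfer_in (esym (Eab v)) xb.
    rewrite -{2}ea ffunE => /imsetP[i iv e]; exists i => //.
    move: iv; rewrite inE => /eqP iv.
    by rewrite ffunE iv -e rank_transferK.
  have hK (a b : {ffun Z -> {set 'I_D}}) (t : {ffun I -> 'I_D}) :
      (forall v, #|a v| = #|b v|) -> im t = a -> h b a (h a b t) = t.
    move=> Eab ea; have ti i : t i \in a (alpha i) by rewrite -ea.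
    by apply/ffunP => i; rewrite !ffunE rank_transferK.
  rewrite /g (reindex_onto (h s' s) (h s s')); last by move=> t /eqP; exact: hK.
  apply: eq_big => [t|t /andP[/eqP e1 /eqP e2]].
    apply/andP/eqP => [[/eqP e1 /eqP <-]|e]; first exact: him.
    by split; apply/eqP; [apply: him | apply: hK].
  apply: Ginv => i j Eij.
  have e3 : im t = s' by rewrite -e2; apply: him.
  have ti k : t k \in s' (alpha k) by rewrite -e3.
  by rewrite !ffunE -Eij leq_rank_transfer // Eij.
(* Initial segments represent all families of sets with given sizes; [kappa l] is the group sum at
   the initial segments of sizes l. *)
pose ini (l : Z -> nat) : {ffun Z -> {set 'I_D}} := [ffun v => [set x : 'I_D | (x < l v)%N]].
have card_ini l v : (l v <= D)%N -> #|ini l v| = l v.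
  move=> lD; have winj : injective (widen_ord lD) by move=> a b /(congr1 val) /= /val_inj.
  rewrite ffunE -[RHS]card_ord -(card_imset _ winj).
  apply: eq_card => x; rewrite inE; apply/idP/imsetP => [lt|[y _ ->]]; last by rewrite /= ltn_ord.
  by exists (Ordinal lt) => //; apply: val_inj.
have lD (l : {ffun Z -> 'I_D.+1}) v : (l v <= D)%N by rewrite -ltnS.
exists (fun l : {ffun Z -> 'I_D.+1} => g (ini (fun v => l v))); split=> [l v|n nD].
  rewrite -[X in (X <= _)%N](card_ini (fun v => l v : nat)) // leqNgt => nz.
  apply/negP => lt; case/eqP: nz; rewrite /g big1 // => t /eqP e; move: lt.
  by rewrite -e ffunE ltnNge leq_imset_card.
rewrite (partition_big im predT) //=.
have -> : \sum_s \sum_(t : {ffun I -> 'I_D} | [forall i, (t i < n (alpha i))%N] && (im t == s)) G t =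
          \sum_(s : {ffun Z -> {set 'I_D}} | [forall v, s v \subset ini n v]) g s.
  rewrite [RHS]big_mkcond; apply: eq_bigr => s _; case: ifPn => [/forallP hs|/forallPn[v hv]].
    apply: eq_bigl => t; case: eqP => [e|]; rewrite ?andbF // andbT.
    apply/forallP => i; have /subsetP := hs (alpha i); rewrite -e => /(_ _ (im_in t i)).
    by rewrite ffunE inE.
  apply: big1 => t /andP[/forallP lt /eqP e]; case/negP: hv; apply/subsetP => x.
  by rewrite -e ffunE => /imsetP[i]; rewrite inE ffunE inE => /eqP <- ->; exact: lt.
pose sz (s : {ffun Z -> {set 'I_D}}) : {ffun Z -> 'I_D.+1} := [ffun v => inord #|s v|].
have szE s v : sz s v = #|s v| :> nat.
  by rewrite ffunE inordK // ltnS -[X in (_ <= X)%N]card_ord max_card.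
rewrite (partition_big sz predT) //=; apply: eq_bigr => l _.
(* The product of binomials counts the families of sets of sizes l inside the initial segments of
   sizes n. *)
have -> : \prod_v ('C(n v, l v))%:R =
          \sum_(s : {ffun Z -> {set 'I_D}} | [forall v, s v \subset ini n v] && (sz s == l)) 1 :> R.
  rewrite (eq_bigr (fun v => \sum_(A : {set 'I_D} | (A \subset ini n v) && (#|A| == l v)) 1 : R)); last first.
    move=> v _; rewrite sumr_const -[in LHS](card_ini n v (nD v)) -cards_draws.
    by congr (_ %:R); apply: eq_card => A; rewrite inE.
  rewrite bigA_distr_big_dep; apply: eq_big => [s|s _]; last by rewrite big1.
  apply/familyP/andP => [h|[/forallP h /eqP e] v]; last first.
    by rewrite unfold_in h /= -szE e.
  split; first by apply/forallP => v; have /andP[] := h v.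
  by apply/eqP/ffunP => v; apply: val_inj; rewrite /= szE; have /andP[_ /eqP] := h v.
rewrite big_distrr /=; apply: eq_bigr => s /andP[_ /eqP <-].
by rewrite mulr1; apply: gE => v; rewrite card_ini // szE.
Qed.

(** * Random fillings of the blocks *)

(* A block of mass D of kind k consists of [units k] atoms of mass 1 followed by
   [atoms k] atoms of mass [width k]. *)
Record gadget (D : nat) := Gadget {
  kind : finType;
  units : kind -> nat;
  atoms : kind -> nat;
  width : kind -> nat;
  width_gt0 : forall k, (0 < width k)%N;
  total_mass : forall k, (units k + atoms k * width k = D)%N
}.

(** Either disjunct makes the first D - s units of the block consist of atoms of mass 1, so that
    every bin boundary of q in the block falls between two atoms. *)
Definition yes_kind (D : nat) (g : gadget D) (s : nat) (k : kind g) : bool :=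
  (units k == 0%N) && (width k == 1%N) || (D - s <= units k)%N.

Definition far_kind (D : nat) (g : gadget D) (k : kind g) : bool :=
  (units k == 0%N) && (width k == 2%N).

(** The factor of a block in the weight of the samples with c hits on its wide atoms, l0 distinct
    unit atoms and l1 distinct wide atoms being hit: the binomials choose these atoms, and a hit on
    a wide atom has probability proportional to its width. *)
Definition block_moment (D : nat) (g : gadget D) (c l0 l1 : nat) (k : kind g) : nat :=
  (width k ^ c * 'C(units k, l0) * 'C(atoms k, l1))%N.

(** c0 and c1 stand for the numbers of samples on unit and on wide atoms; they bound the numbers l0
    and l1 of distinct atoms hit. *)
Definition moments_match (D : nat) (g : gadget D) (r : nat) (pi pi' : kind g -> R) : Prop :=
  forall c0 c1 l0 l1, (l0 <= c0)%N -> (l1 <= c1)%N -> (c0 + c1 <= r)%N ->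
    \sum_k pi k * (block_moment c1 l0 l1 k)%:R = \sum_k pi' k * (block_moment c1 l0 l1 k)%:R.

Definition prob_on (K : finType) (pi : K -> R) : Prop :=
  (forall k, 0 <= pi k) /\ \sum_k pi k = 1.

Definition expect (B : nat) (K : finType) (pi : K -> R) (X : {ffun 'I_B -> K} -> R) : R :=
  (\sum_(tau : {ffun 'I_B -> K}) (\prod_b pi (tau b)) * X tau)%R.

(* Zone (b, false) holds the unit atoms of block b, zone (b, true) its wide atoms. *)
Definition zone (B : nat) : finType := ('I_B * bool)%type.
Definition slot (B D : nat) : finType := (zone B * 'I_D)%type.

Definition zone_atoms (D : nat) (g : gadget D) (B : nat) (tau : {ffun 'I_B -> kind g})
    (v : zone B) : nat :=
  if v.2 then atoms (tau v.1) else units (tau v.1).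

Definition zone_width (D : nat) (g : gadget D) (B : nat) (tau : {ffun 'I_B -> kind g})
    (v : zone B) : nat :=
  if v.2 then width (tau v.1) else 1.

(** Every zone has D slots whatever the filling, so that the sample space is the same for all tau;
    slots beyond the number of atoms have weight 0. *)
Definition slot_weight (D : nat) (g : gadget D) (B : nat) (tau : {ffun 'I_B -> kind g})
    (j : slot B D) : R :=
  (if (j.2 < zone_atoms tau j.1)%N then (zone_width tau j.1)%:R / (B * D)%:R else 0)%R.

(** Lexicographic order: block, then unit atoms before wide atoms, then position in the zone. *)
Definition slot_code (B D : nat) (j : slot B D) : nat :=
  ((j.1.1 * 2 + j.1.2) * D + j.2)%N.

Definition label_dist (D : nat) (g : gadget D) (B n : nat) (z : nat -> 'I_n)
    (tau : {ffun 'I_B -> kind g}) (i : 'I_n) : R :=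
  (\sum_(j : slot B D | z (slot_code j) == i) slot_weight tau j)%R.

Definition order_acc (D : nat) (g : gadget D) (B m : nat) (F : ('I_m -> nat) -> R)
    (tau : {ffun 'I_B -> kind g}) : R :=
  (\sum_(w : {ffun 'I_m -> slot B D}) (\prod_i slot_weight tau (w i)) *
    F (fun i => slot_code (w i)))%R.

Lemma acc_prob_pushforward (n m : nat) (J : finType) (mu : J -> R) (z : J -> 'I_n)
    (T : m.-tuple 'I_n -> R) :
  acc_prob (fun i => \sum_(j | z j == i) mu j) T =
  \sum_(w : {ffun 'I_m -> J}) (\prod_i mu (w i)) * T [tuple z (w i) | i < m].
Proof.
rewrite /acc_prob.
rewrite (eq_bigr (fun x : m.-tuple 'I_n =>
  \sum_(w : {ffun 'I_m -> J} | [forall i, z (w i) == tnth x i])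
     (\prod_i mu (w i)) * T x)); last first.
  move=> x _; rewrite bigA_distr_big_dep big_distrl /=; apply: eq_bigl => w.
  by apply/familyP/forallP.
rewrite (exchange_big_dep predT) //=; apply: eq_bigr => w _.
rewrite (big_pred1 [tuple z (w i) | i < m]) // => x /=.
apply/forallP/eqP => [h|-> i]; last by rewrite tnth_mktuple.
by apply: eq_from_tnth => i; rewrite tnth_mktuple; apply/esym/eqP.
Qed.

Lemma sum_prod_ffun (I J : finType) (F : I -> J -> R) (a : I -> R) :
  (forall i, \sum_j F i j = a i) -> \sum_(w : {ffun I -> J}) \prod_i F i (w i) = \prod_i a i.
Proof. by move=> h; rewrite -bigA_distr_bigA; apply: eq_bigr. Qed.

Lemma sum_ord_lt (D n : nat) (c : R) : (n <= D)%N ->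
  \sum_(t < D) (if (t < n)%N then c else 0) = c * n%:R.
Proof.
move=> nD; rewrite -big_mkcond (big_ord_narrow nD) /= sumr_const card_ord.
by rewrite mulr_natr.
Qed.

Lemma units_le (D : nat) (g : gadget D) (k : kind g) : (units k <= D)%N.
Proof. by apply: leq_trans (leq_addr _ _) (eq_leq (total_mass k)). Qed.

Lemma atoms_le (D : nat) (g : gadget D) (k : kind g) : (atoms k <= D)%N.
Proof.
apply: leq_trans (eq_leq (total_mass k)); apply: leq_trans (leq_addl _ _).
by rewrite leq_pmulr ?width_gt0.
Qed.

Lemma zone_atoms_le (D : nat) (g : gadget D) (B : nat) (tau : {ffun 'I_B -> kind g}) v :
  (zone_atoms tau v <= D)%N.
Proof. by rewrite /zone_atoms; case: ifP => _; rewrite ?units_le ?atoms_le. Qed.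

Lemma slot_weight_ge0 (D : nat) (g : gadget D) (B : nat) (tau : {ffun 'I_B -> kind g}) j :
  0 <= slot_weight tau j.
Proof. by rewrite /slot_weight; case: ifP => _ //; rewrite divr_ge0 ?ler0n. Qed.

Lemma zone_weight (D : nat) (g : gadget D) (B : nat) (tau : {ffun 'I_B -> kind g}) v :
  \sum_t slot_weight tau (v, t) = (zone_atoms tau v * zone_width tau v)%:R / (B * D)%:R.
Proof.
rewrite /slot_weight /= sum_ord_lt ?zone_atoms_le // [in RHS]natrM; ring.
Qed.

Lemma block_weight (D : nat) (g : gadget D) (B : nat) (tau : {ffun 'I_B -> kind g}) b :
  (0 < D)%N -> \sum_e \sum_t slot_weight tau ((b, e), t) = B%:R^-1.
Proof.
move=> D0; rewrite big_bool /= !zone_weight -mulrDl -natrD /zone_atoms /zone_width /= muln1.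
rewrite addnC total_mass natrM invfM mulrCA mulfV ?mulr1 //.
by rewrite pnatr_eq0 -lt0n.
Qed.

Lemma sum_slot (B D : nat) (f : slot B D -> R) :
  \sum_j f j = \sum_b \sum_e \sum_t f ((b, e), t).
Proof.
by rewrite pair_bigA pair_bigA /=; apply: eq_bigr => -[[b e] t].
Qed.

Lemma total_slot_weight (D : nat) (g : gadget D) (B : nat) (tau : {ffun 'I_B -> kind g}) :
  (0 < D)%N -> (0 < B)%N -> \sum_j slot_weight tau j = 1.
Proof.
move=> D0 B0; rewrite sum_slot (eq_bigr (fun=> B%:R^-1)); last by move=> b _; exact: block_weight.
by rewrite sumr_const card_ord -[_ *+ _]mulr_natr mulVf // pnatr_eq0 -lt0n.
Qed.

Lemma slot_code_lt (B D : nat) (j : slot B D) : (slot_code j < B.*2 * D)%N.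
Proof.
case: j => -[b e] t; rewrite /slot_code /=.
have hb := ltn_ord b; have ht := ltn_ord t.
have h : (b * 2 + e < B.*2)%N by rewrite -mul2n; case: e => /=; lia.
by apply: (@leq_trans ((b * 2 + e).+1 * D)%N); [rewrite mulSn; lia | rewrite leq_mul2r h orbT].
Qed.

Lemma slot_code_lt_zone (B D : nat) (j j' : slot B D) :
  (j.1.1 * 2 + j.1.2 < j'.1.1 * 2 + j'.1.2)%N -> (slot_code j < slot_code j')%N.
Proof.
move=> h; apply: leq_trans (leq_addr _ _); apply: leq_trans (leq_mul h (leqnn D)).
by rewrite /slot_code mulSn [X in (_ < X)%N]addnC ltn_add2l ltn_ord.
Qed.

Lemma zone_rank_inj (B : nat) (v v' : zone B) :
  (v.1 * 2 + v.2 = v'.1 * 2 + v'.2)%N -> v = v'.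
Proof.
case: v v' => [b e] [b' e'] /= E.
have e1 : e = e' by case: e e' E => -[] /=; lia.
by rewrite e1 in E *; congr pair; apply: val_inj => /=; lia.
Qed.

Lemma slot_code_inj (B D : nat) : injective (@slot_code B D).
Proof.
move=> j j' E.
have Ev : j.1 = j'.1.
  apply: zone_rank_inj; case: (ltngtP (j.1.1 * 2 + j.1.2) (j'.1.1 * 2 + j'.1.2)) => // h.
    by have := slot_code_lt_zone h; rewrite E ltnn.
  by have := slot_code_lt_zone h; rewrite E ltnn.
case: j j' Ev E => v t [v' t'] /= <-; rewrite /slot_code /= => /addnI/val_inj-> //.
Qed.

Definition zone_acc (D : nat) (g : gadget D) (B m : nat) (F : ('I_m -> nat) -> R)
    (tau : {ffun 'I_B -> kind g}) (alpha : {ffun 'I_m -> zone B}) : R :=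
  (\sum_(t : {ffun 'I_m -> 'I_D}) (\prod_i slot_weight tau (alpha i, t i)) *
    F (fun i => slot_code (alpha i, t i)))%R.

Lemma order_acc_split (D : nat) (g : gadget D) (B m : nat) (F : ('I_m -> nat) -> R)
    (tau : {ffun 'I_B -> kind g}) :
  order_invariant F -> order_acc F tau = \sum_alpha zone_acc F tau alpha.
Proof.
move=> Finv; rewrite /order_acc /zone_acc pair_bigA /=.
pose h (p : {ffun 'I_m -> zone B} * {ffun 'I_m -> 'I_D}) : {ffun 'I_m -> slot B D} :=
  [ffun i => (p.1 i, p.2 i)].
rewrite (reindex h) /=; last first.
  exists (fun w : {ffun 'I_m -> slot B D} => ([ffun i => (w i).1], [ffun i => (w i).2])).
    by move=> [a t] _; congr pair; apply/ffunP => i; rewrite !ffunE.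
  by move=> w _; apply/ffunP => i; rewrite !ffunE /=; case: (w i).
apply: eq_bigr => -[a t] _ /=; congr (_ * _).
  by apply: eq_bigr => i _; rewrite ffunE.
by apply: Finv => i j; rewrite !ffunE.
Qed.

Lemma prod_zone_width (D : nat) (g : gadget D) (B m : nat) (tau : {ffun 'I_B -> kind g})
    (alpha : {ffun 'I_m -> zone B}) :
  \prod_i (zone_width tau (alpha i))%:R =
  \prod_b (width (tau b))%:R ^+ #|[set i | alpha i == (b, true)]| :> R.
Proof.
rewrite (partition_big alpha predT) //=.
rewrite (eq_bigr (fun v : zone B => (zone_width tau v)%:R ^+ #|[set i | alpha i == v]|)); last first.
  move=> v _; rewrite (eq_bigr (fun=> (zone_width tau v)%:R)) => [|i /eqP-> //].
  by rewrite prodr_const; congr (_ ^+ _); apply: eq_card => i; rewrite inE.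
rewrite (eq_bigr (fun v : zone B => (zone_width tau (v.1, v.2))%:R ^+
  #|[set i | alpha i == (v.1, v.2)]|)) => [|[] //].
rewrite -(pair_bigA _ (fun b e => (zone_width tau (b, e))%:R ^+ #|[set i | alpha i == (b, e)]|)) /=.
by apply: eq_bigr => b _; rewrite big_bool /= /zone_width /= expr1n mulr1.
Qed.

(** All occupied slots of a zone have equal weight, so [zone_acc] is a product of widths times a sum
    of F over occupied slots, to which [zone_count] applies. Regrouping the zones by blocks gives
    the moments, with a [kappa] common to all tau. *)
Lemma zone_acc_formula (D : nat) (g : gadget D) (B m : nat) (F : ('I_m -> nat) -> R)
    (alpha : {ffun 'I_m -> zone B}) :
  order_invariant F ->
  exists kappa : {ffun zone B -> 'I_D.+1} -> R,
    (forall l v, kappa l != 0 -> (l v <= #|[set i | alpha i == v]|)%N) /\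
    forall tau : {ffun 'I_B -> kind g}, zone_acc F tau alpha =
      \sum_l kappa l * ((B * D)%:R ^- m * \prod_b
        (block_moment #|[set i | alpha i == (b, true)]| (l (b, false)) (l (b, true)) (tau b))%:R).
Proof.
move=> Finv.
have [t t' Et|kappa [supp Ek]] := @zone_count _ _ D alpha
    (fun t : {ffun 'I_m -> 'I_D} => F (fun i => slot_code (alpha i, t i))).
  (* Slots of different zones compare by zone alone, so only comparisons inside a zone can change
     with t. *)
  apply: Finv => i j; have [e|ne] := eqVneq (alpha i) (alpha j).
    by rewrite /slot_code /= e !leq_add2l Et.
  case: (ltngtP ((alpha i).1 * 2 + (alpha i).2) ((alpha j).1 * 2 + (alpha j).2)) => h.
  - have lt (s s' : 'I_D) : (slot_code (alpha i, s) < slot_code (alpha j, s'))%N.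
      exact: slot_code_lt_zone.
    by rewrite (ltnW (lt (t i) (t j))) (ltnW (lt (t' i) (t' j))).
  - have gt (s s' : 'I_D) : (slot_code (alpha i, s) <= slot_code (alpha j, s'))%N = false.
      by apply/negbTE; rewrite -ltnNge; exact: slot_code_lt_zone.
    by rewrite !gt.
  - by case/eqP: ne; apply: zone_rank_inj.
exists kappa; split=> // tau.
have := Ek (zone_atoms tau) (@zone_atoms_le _ _ _ tau) => {}Ek.
transitivity (((B * D)%:R ^- m * \prod_i (zone_width tau (alpha i))%:R) *
    \sum_l kappa l * \prod_v ('C(zone_atoms tau v, l v))%:R).
  rewrite -Ek /zone_acc big_distrr [RHS]big_mkcond /=; apply: eq_bigr => t _.
  case: ifPn => [/forallP h|/forallPn[i hi]]; last first.
    by rewrite (bigD1 i) //= /slot_weight /= (negbTE hi) !mul0r.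
  congr (_ * _); rewrite (eq_bigr (fun i => (zone_width tau (alpha i))%:R * (B * D)%:R^-1)).
    by rewrite big_split /= prodr_const card_ord mulrC exprVn.
  by move=> i _; rewrite /slot_weight /= h.
rewrite big_distrr /=; apply: eq_bigr => l _; rewrite mulrCA -!mulrA; congr (_ * (_ * _)).
rewrite prod_zone_width.
rewrite (eq_bigr (fun v : zone B => ('C(zone_atoms tau (v.1, v.2), l (v.1, v.2)))%:R : R)) => [|[] //].
rewrite -(pair_bigA _ (fun b e => ('C(zone_atoms tau (b, e), l (b, e)))%:R : R)) /=.
rewrite -big_split /=; apply: eq_bigr => b _.
by rewrite big_bool /= /zone_atoms /block_moment /= !natrM natrX; ring.
Qed.

Lemma expect_prod (B : nat) (K : finType) (pi : K -> R) (f : 'I_B -> K -> R) :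
  expect pi (fun tau : {ffun 'I_B -> K} => \prod_b f b (tau b)) =
  \prod_b \sum_k pi k * f b k.
Proof. by rewrite bigA_distr_bigA; apply: eq_bigr => tau _; rewrite -big_split. Qed.

Lemma expect_sum (B : nat) (K J : finType) (pi : K -> R) (P : pred J)
    (X : J -> {ffun 'I_B -> K} -> R) :
  expect pi (fun tau => \sum_(j | P j) X j tau) = \sum_(j | P j) expect pi (X j).
Proof. by rewrite exchange_big /=; apply: eq_bigr => tau _; rewrite big_distrr. Qed.

Lemma expect_scale (B : nat) (K : finType) (pi : K -> R) (c : R) (X : {ffun 'I_B -> K} -> R) :
  expect pi (fun tau => c * X tau) = c * expect pi X.
Proof. by rewrite /expect big_distrr; apply: eq_bigr => tau _; rewrite mulrCA. Qed.

Lemma eq_expect (B : nat) (K : finType) (pi : K -> R) (X Y : {ffun 'I_B -> K} -> R) :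
  X =1 Y -> expect pi X = expect pi Y.
Proof. by move=> E; apply: eq_bigr => tau _; rewrite E. Qed.

Lemma expect_const (B : nat) (K : finType) (pi : K -> R) (c : R) :
  prob_on pi -> expect pi (fun _ : {ffun 'I_B -> K} => c) = c.
Proof.
case=> _ E; rewrite /expect -big_distrl /= (sum_prod_ffun (F := fun _ k => pi k) (a := fun=> 1)) //.
by rewrite big1 // mul1r.
Qed.

Lemma le_expect (B : nat) (K : finType) (pi : K -> R) (X Y : {ffun 'I_B -> K} -> R) :
  prob_on pi -> (forall tau : {ffun 'I_B -> K}, (forall b, pi (tau b) != 0) -> X tau <= Y tau) ->
  expect pi X <= expect pi Y.
Proof.
move=> [p0 _] h; apply: ler_sum => tau _.
have [/forallP nz|/forallPn[b]] := boolP [forall b, pi (tau b) != 0].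
  by apply: ler_wpM2l; [apply: prodr_ge0 | apply: h].
by rewrite negbK => /eqP z; rewrite (bigD1 b) //= z !mul0r.
Qed.

(** As [kappa] does not involve tau and the blocks are independent, the expectation is a combination
    of products of block moments. Each moment involves at most r samples, hence is the same under
    both laws. *)
Lemma expect_zone_acc_eq (D : nat) (g : gadget D) (B m r : nat) (F : ('I_m -> nat) -> R)
    (pi pi' : kind g -> R) (alpha : {ffun 'I_m -> zone B}) :
  order_invariant F -> moments_match r pi pi' ->
  (forall b, #|[set i | (alpha i).1 == b]| <= r)%N ->
  expect pi (fun tau => zone_acc F tau alpha) = expect pi' (fun tau => zone_acc F tau alpha).
Proof.
move=> Finv mm hr; have [kappa [supp E]] := zone_acc_formula g alpha Finv.
rewrite !(eq_expect _ E) !expect_sum; apply: eq_bigr => l _.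
have [->|nz] := eqVneq (kappa l) 0; first by rewrite !expect_scale !mul0r.
rewrite !expect_scale; congr (_ * (_ * _)).
rewrite !(expect_prod _ (fun b k => (block_moment _ (l (b, false)) (l (b, true)) k)%:R)).
apply: eq_bigr => b _; apply: (mm #|[set i | alpha i == (b, false)]|); rewrite ?supp //.
apply: leq_trans (hr b); rewrite -cardsUI [X in (_ + X)%N](_ : _ = 0%N) ?addn0; last first.
  apply/eqP; rewrite cards_eq0; apply/eqP/setP => i; rewrite !inE.
  by case: eqP => // ->; rewrite xpair_eqE andbF.
by apply: subset_leq_card; apply/subsetP => i; rewrite !inE => /orP[]/eqP->.
Qed.

Definition crowded (B m r : nat) (alpha : {ffun 'I_m -> zone B}) : bool :=
  [exists b, (r < #|[set i | (alpha i).1 == b]|)%N].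

(* Union bound over the blocks and the sets of r+1 samples falling in one block. *)
Lemma crowded_weight (D : nat) (g : gadget D) (B m r : nat) (tau : {ffun 'I_B -> kind g}) :
  (0 < D)%N -> (0 < B)%N ->
  \sum_(alpha : {ffun 'I_m -> zone B} | crowded r alpha)
    \prod_i (\sum_t slot_weight tau (alpha i, t)) <= ('C(m, r.+1))%:R / B%:R ^+ r.
Proof.
move=> D0 B0; pose u v := \sum_t slot_weight tau (v, t).
have u0 v : 0 <= u v by apply: sumr_ge0 => t _; exact: slot_weight_ge0.
have ub b : \sum_(v | v.1 == b) u v = B%:R^-1.
  rewrite -(block_weight tau b D0) (eq_big (fun v : zone B => (v.1 == b) && predT v.2)
    (fun v => u (v.1, v.2))) => [|v|[] //]; last by rewrite andbT.
  by rewrite -(pair_big (fun b' => b' == b) predT (fun b e => u (b, e))) /= big_pred1_eq.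
have u1 : \sum_v u v = 1.
  by rewrite -(total_slot_weight tau D0 B0) pair_bigA; apply: eq_bigr => -[].
pose ind (S : {set 'I_m}) b i (v : zone B) : R := if i \in S then (v.1 == b)%:R else 1.
have ind0 S b i v : 0 <= ind S b i v by rewrite /ind; case: ifP; rewrite ?ler0n ?ler01.
pose term (alpha : {ffun 'I_m -> zone B}) S b : R := \prod_i (u (alpha i) * ind S b i (alpha i)).
have term0 alpha S b : 0 <= term alpha S b by apply: prodr_ge0 => i _; rewrite mulr_ge0.
(* A crowded alpha has a block b with a set S of r+1 samples in it, and its weight reappears as the
   term of this pair. *)
apply: (@le_trans _ _ (\sum_alpha \sum_(S : {set 'I_m} | #|S| == r.+1) \sum_b term alpha S b)).
  rewrite [leLHS]big_mkcond; apply: ler_sum => alpha _; case: ifP => [/existsP[b hb]|_]; last first.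
    by apply: sumr_ge0 => S _; apply: sumr_ge0 => b _.
  have [S] : exists S : {set 'I_m}, S \in [set A : {set 'I_m} |
      (A \subset [set i | (alpha i).1 == b]) && (#|A| == r.+1)].
    by apply/set0Pn; rewrite -card_gt0 cards_draws bin_gt0.
  rewrite inE => /andP[/subsetP Sb cS].
  rewrite (bigD1 S) //= (bigD1 b) //= -addrA ler_wpDr //; last first.
    rewrite /term le_eqVlt; apply/predU1P; left; apply: eq_bigr => i _.
    by rewrite /ind; case: ifP => [/Sb|_]; rewrite ?inE ?mulr1 // => ->; rewrite mulr1.
  by rewrite addr_ge0 ?sumr_ge0 // => S' _; rewrite sumr_ge0.
(* For each S, the r+1 samples all hit b with probability B^-(r+1), and the B choices of b give
   B^-r. *)
rewrite exchange_big /= (eq_bigr (fun=> (B%:R ^+ r)^-1)) => [|S /eqP cS].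
  rewrite sumr_const -[in leRHS](card_ord m) -card_draws -[leLHS]mulr_natl.
  by rewrite le_eqVlt; apply/predU1P; left; congr (_%:R * _); apply: eq_card => S; rewrite inE.
rewrite exchange_big /= (eq_bigr (fun=> (B%:R ^+ r.+1)^-1)) => [|b _].
  rewrite sumr_const card_ord -[LHS]mulr_natl exprS invfM mulVKf //.
  by rewrite pnatr_eq0 -lt0n.
rewrite (sum_prod_ffun (F := fun i v => u v * ind S b i v)
  (a := fun i => if i \in S then B%:R^-1 else 1)) => [|i].
  by rewrite -big_mkcond /= prodr_const cS exprVn.
rewrite /ind; case: ifP => _; last by rewrite -[RHS]u1; apply: eq_bigr => v _; rewrite mulr1.
rewrite -(ub b) [RHS]big_mkcond; apply: eq_bigr => v _.
by case: eqP; rewrite ?mulr1 ?mulr0.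
Qed.

Lemma zone_acc_bounds (D : nat) (g : gadget D) (B m : nat) (F : ('I_m -> nat) -> R)
    (tau : {ffun 'I_B -> kind g}) (alpha : {ffun 'I_m -> zone B}) :
  (forall w, 0 <= F w <= 1) ->
  0 <= zone_acc F tau alpha <= \prod_i (\sum_t slot_weight tau (alpha i, t)).
Proof.
move=> F01; rewrite bigA_distr_bigA /=.
have w0 (t : {ffun 'I_m -> 'I_D}) : 0 <= \prod_i slot_weight tau (alpha i, t i).
  by apply: prodr_ge0 => i _; exact: slot_weight_ge0.
apply/andP; split.
  by apply: sumr_ge0 => t _; rewrite mulr_ge0 //; have /andP[] := F01 (fun i => slot_code (alpha i, t i)).
apply: ler_sum => t _; rewrite ler_piMr //.
by have /andP[] := F01 (fun i => slot_code (alpha i, t i)).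
Qed.

(** Assignments that are not crowded contribute equally under both laws. Both crowded parts lie
    between 0 and the bound, so their difference costs it only once. *)
Lemma expect_order_acc_close (D : nat) (g : gadget D) (B m r : nat)
    (F : ('I_m -> nat) -> R) (pi pi' : kind g -> R) :
  (0 < D)%N -> (0 < B)%N -> prob_on pi -> prob_on pi' ->
  order_invariant F -> (forall w, 0 <= F w <= 1) -> moments_match r pi pi' ->
  `|expect pi (fun tau : {ffun 'I_B -> _} => order_acc F tau) -
    expect pi' (fun tau : {ffun 'I_B -> _} => order_acc F tau)| <=
    ('C(m, r.+1))%:R / B%:R ^+ r.
Proof.
move=> D0 B0 hp hp' Finv F01 mm.
have bad (nu : kind g -> R) : prob_on nu ->
    0 <= \sum_(alpha | crowded r alpha)
      expect nu (fun tau : {ffun 'I_B -> kind g} => zone_acc F tau alpha) <=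
    ('C(m, r.+1))%:R / B%:R ^+ r.
  move=> hnu; rewrite -expect_sum; apply/andP; split.
    rewrite -[leLHS](expect_const B 0 hnu); apply: le_expect => // tau _; apply: sumr_ge0 => alpha _.
    by have /andP[] := zone_acc_bounds tau alpha F01.
  rewrite -[leRHS](expect_const B _ hnu); apply: le_expect => // tau _.
  apply: le_trans (crowded_weight _ _ tau D0 B0); apply: ler_sum => alpha _.
  by have /andP[] := zone_acc_bounds tau alpha F01.
rewrite !(eq_expect _ (fun tau => order_acc_split tau Finv)) !expect_sum.
rewrite (bigID (crowded r)) [X in _ - X](bigID (crowded r)) /=.
rewrite [X in _ - (_ + X)](eq_bigr (fun alpha =>
  expect pi (fun tau : {ffun 'I_B -> kind g} => zone_acc F tau alpha))); last first.
  move=> alpha /existsPn h; apply/esym; apply: expect_zone_acc_eq mm _ => // b.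
  by rewrite leqNgt.
have := bad _ hp; have := bad _ hp'.
set p := \sum_(_ | crowded _ _) _; set p' := \sum_(_ | crowded _ _) _.
set q := \sum_(_ | _) _; set e := _ / _ => /andP[h1 h2] /andP[h3 h4].
by rewrite opprD addrACA subrr addr0; rewrite ler_norml; apply/andP; split; lra.
Qed.

(** * Divided differences *)

(** The sum is the coefficient of degree [#|I|] - 1 of the interpolation polynomial q of p at the
    nodes. As q = p and p has lower degree, it vanishes. *)
Lemma divided_difference (F : fieldType) (I : finType) (a : I -> F) (p : {poly F}) :
  injective a -> (size p < #|I|)%N ->
  \sum_i p.[a i] / \prod_(j | j != i) (a i - a j) = 0.
Proof.
move=> ainj sp.
pose w i := \prod_(j | j != i) (a i - a j).
pose e i : {poly F} := \prod_(j | j != i) ('X - (a j)%:P).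
have w0 i : w i != 0.
  by apply/prodf_neq0 => j ji; rewrite subr_eq0 (inj_eq ainj) eq_sym.
have eE i : e i = \prod_(j <- [seq j <- index_enum I | j != i]) ('X - (a j)%:P).
  by rewrite big_filter.
have se i : size (e i) = #|I|.
  rewrite eE size_prod_XsubC size_filter.
  have := count_predC (pred1 i) (index_enum I).
  rewrite (count_uniq_mem _ (index_enum_uniq I)) mem_index_enum.
  by rewrite cardT enumT => <-.
pose q := \sum_i (p.[a i] / w i) *: e i.
have qE i : q.[a i] = p.[a i].
  rewrite /q horner_sum (bigD1 i) //= big1 ?addr0 => [|j ji].
    rewrite hornerZ horner_prod (eq_bigr (fun j => a i - a j)) => [|j _].
      by rewrite -/(w i) divfK.
    by rewrite hornerXsubC.
  rewrite hornerZ horner_prod (bigD1 i) 1?eq_sym //= hornerXsubC subrr mul0r mulr0 //.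
have sq : (size q <= #|I|)%N.
  apply: leq_trans (size_sum _ _ _) _; apply/bigmax_leqP => i _.
  by apply: leq_trans (size_scale_leq _ _) _; rewrite se.
have pq : p = q.
  apply/eqP; rewrite -subr_eq0; apply/negPn/negP => nz.
  have := @max_poly_roots _ _ [seq a i | i <- enum I] nz.
  rewrite (map_inj_uniq ainj) enum_uniq size_map -cardE => H.
  have : (#|I| < size (p - q)%R)%N.
    apply: H => //; apply/allP => x /mapP[i _ ->].
    by rewrite rootE hornerD hornerN qE subrr.
  apply/negP; rewrite -leqNgt; apply: leq_trans (size_polyD _ _) _.
  by rewrite size_polyN geq_max sq ltnW.
have : q`_(#|I|.-1) = 0.
  by rewrite -pq; apply: nth_default; case: #|I| sp.
rewrite /q coef_sum => E; rewrite -[RHS]E; apply: eq_bigr => i _; rewrite coefZ.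
have -> : (e i)`_(#|I|.-1) = 1; last by rewrite mulr1.
by rewrite -(se i) -/(lead_coef _); apply/monicP; exact: monic_prod_XsubC.
Qed.

Lemma bin_poly (l : nat) :
  exists2 P : {poly R}, (size P <= l.+1)%N & forall n, ('C(n, l))%:R = P.[n%:R].
Proof.
pose e : {poly R} := \prod_(j < l) ('X - (j%:R)%:P).
exists ((l`!)%:R^-1 *: e).
  apply: leq_trans (size_scale_leq _ _) _.
  rewrite /e -(big_map (fun j : 'I_l => j%:R) predT (fun c : R => 'X - c%:P)).
  rewrite size_prod_XsubC size_map.
  have -> // : size (index_enum 'I_l) = l by rewrite -[RHS](card_ord l) cardT enumT.
move=> n; have l0 : (l`!)%:R != 0 :> R by rewrite pnatr_eq0 -lt0n fact_gt0.
rewrite hornerZ; apply: (canRL (mulKf l0)); rewrite -natrM mulnC bin_ffact {}/e horner_prod.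
elim: l {l0} => [|l IH]; first by rewrite big_ord0.
rewrite big_ord_recr /= -IH ffactnSr natrM hornerXsubC.
have [ln|nl] := leqP l n; first by rewrite natrB.
by rewrite ffact_small // !mul0r.
Qed.

Lemma prod_dist_fact (r i : nat) : (i <= r)%N ->
  (\prod_(0 <= j < r.+1 | j != i) (if j < i then i - j else j - i) = i`! * (r - i)`!)%N.
Proof.
move=> ir; rewrite (@big_cat_nat _ _ _ i.+1) //= big_mkcond big_nat_recr //= eqxx muln1.
congr (_ * _)%N.
  rewrite fact_prod big_add1 big_nat_rev /=; apply: eq_big_nat => j /= ji.
  have h : (0 + i - j.+1 < i)%N by lia.
  by rewrite add0n in h *; rewrite h (ltn_eqF h) /= subKn.
rewrite -{1}[i.+1]add0n big_addn subSS fact_prod [RHS]big_add1 /=.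
rewrite big_mkcond; apply: eq_big_nat => j _.
by rewrite ifT; [rewrite ifF; lia | lia].
Qed.

(* Via (r+1)^r <= (2r)(2r-1)...(r+1) = C(2r,r) r! and r! = C(r,i) i! (r-i)!. *)
Lemma pow_le_fact (r i : nat) : (i <= r)%N ->
  ((16 * r.+1) ^ r <= 2 ^ (7 * r) * (i`! * (r - i)`!))%N.
Proof.
move=> ir.
have bin2 n k : ('C(n, k) <= 2 ^ n)%N.
  have [kn|nk] := leqP k n; last by rewrite bin_small.
  rewrite -[2%N]/(1 + 1)%N expnDn (bigD1 (Ordinal (kn : k < n.+1)%N)) //=.
  by rewrite !exp1n !muln1 leq_addr.
have h1 : (r.+1 ^ r <= (r + r) ^_ r)%N.
  rewrite ffact_prod -[X in (_ ^ X)%N]card_ord -prod_nat_const; apply: leq_prod => j _.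
  by have := ltn_ord j; lia.
have h2 : (r.+1 ^ r <= 2 ^ (2 * r) * r`!)%N.
  apply: leq_trans h1 _; rewrite -bin_ffact leq_mul2r; apply/orP; right.
  by rewrite mul2n -addnn bin2.
have h3 : (r`! <= 2 ^ r * (i`! * (r - i)`!))%N.
  by rewrite -(bin_fact ir) leq_mul2r bin2 orbT.
rewrite expnMn -[16%N]/(2 ^ 4)%N -expnM.
have -> : (7 * r = 4 * r + 2 * r + r)%N by lia.
rewrite (expnD 2 (4 * r + 2 * r)) (expnD 2 (4 * r)) -!mulnA leq_mul2l; apply/orP; right.
by apply: leq_trans h2 _; rewrite leq_mul2l h3 orbT.
Qed.

(** Jordan decomposition: zero total mass gives the positive and the negative part the same mass W.
    A weight of at least 1 makes W >= 1, so that normalizing does not enlarge the weights. *)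
Lemma signed_split (K : finType) (lam : K -> R) :
  \sum_k lam k = 0 -> (exists k, 1 <= lam k) ->
  exists W, 1 <= W /\ prob_on (fun k => Num.max (lam k) 0 / W) /\
    prob_on (fun k => Num.max (- lam k) 0 / W).
Proof.
move=> S0 [k0 h0].
pose W := \sum_k Num.max (lam k) 0.
have W1 : 1 <= W.
  rewrite /W (bigD1 k0) //= ler_wpDr ?le_max ?h0 //.
  by apply: sumr_ge0 => k _; rewrite le_max lexx orbT.
have W0 : 0 < W by apply: lt_le_trans W1.
exists W; split=> //; split; split.
- by move=> k; rewrite divr_ge0 ?(ltW W0) // le_max lexx orbT.
- by rewrite -mulr_suml divff // gt_eqF.
- by move=> k; rewrite divr_ge0 ?(ltW W0) // le_max lexx orbT.
rewrite -mulr_suml; apply: (canLR (mulfK _)); first by rewrite gt_eqF.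
have E : W = W - \sum_k lam k by rewrite S0 subr0.
rewrite mul1r [RHS]E /W -sumrB; apply: eq_bigr => k _.
by have [] := leP (lam k) 0; have [] := leP (- lam k) 0; lra.
Qed.

Lemma maxB_opp (x : R) : Num.max x 0 - Num.max (- x) 0 = x.
Proof. by have [] := leP x 0; have [] := leP (- x) 0; lra. Qed.

(** The coefficient of the value at a i in the divided difference over the nodes a. *)
Definition dd_weight (I : finType) (a : I -> R) (i : I) : R := ((\prod_(j | j != i) (a i - a j))^-1)%R.

Lemma invr_div_invr (a b : R) : a^-1 / b^-1 = b / a.
Proof. by rewrite invrK mulrC. Qed.

(** With X = 2^(20 r) this is 2^r X, a common multiple of the widths 2^t X, so that atoms of any of
    them can fill it. *)
Definition base_unit (r : nat) : nat := (2 ^ (20 * r) * 2 ^ r)%N.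
(** The block length in base units; with this value, wide atoms on a length of at most r take up at
    most a sixteenth of the block. *)
Definition reach (r : nat) : nat := (16 * r.+1)%N.
Definition heavy_width (r t : nat) : nat := (2 ^ (20 * r) * 2 ^ t)%N.

Definition width_node (r : nat) (v : bool + 'I_r) : R :=
  match v with inl e => if e then 2%R else 1%R | inr t => (heavy_width r t)%:R%R end.
Definition length_node (r : nat) (v : unit + 'I_r.+1) : R :=
  match v with inl _ => (reach r)%:R%R | inr i => i%:R%R end.

(* Divided difference weights normalized at the width 1, and Lagrange weights
   for the extrapolation from 0, ..., r to [reach r]. *)
Definition width_coef (r : nat) (v : bool + 'I_r) : R :=
  (dd_weight (@width_node r) v / dd_weight (@width_node r) (inl false))%R.
Definition length_coef (r : nat) (i : 'I_r.+1) : R :=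
  (- (dd_weight (@length_node r) (inr i) / dd_weight (@length_node r) (inl tt)))%R.

Lemma dd_weight_neq0 (I : finType) (a : I -> R) i : injective a -> dd_weight a i != 0.
Proof.
move=> ai; rewrite invr_neq0 //; apply/prodf_neq0 => j ji.
by rewrite subr_eq0 (inj_eq ai) eq_sym.
Qed.

Lemma heavy_width_ge (r t : nat) : (0 < r)%N -> (4 <= heavy_width r t)%N.
Proof.
move=> r0; apply: (@leq_trans (2 ^ 2 * 2 ^ 0)%N) => //.
by apply: leq_mul; rewrite leq_exp2l //; lia.
Qed.

Lemma width_node_inj (r : nat) : (0 < r)%N -> injective (@width_node r).
Proof.
move=> r0.
have h (t : 'I_r) : 4 <= (heavy_width r t)%:R :> R by rewrite (ler_nat _ 4) heavy_width_ge.
have hi (t t' : 'I_r) : (heavy_width r t)%:R = (heavy_width r t')%:R :> R -> t = t'.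
  move=> /eqP; rewrite eqr_nat eqn_pmul2l ?expn_gt0 // eqn_exp2l // => /eqP.
  exact: val_inj.
move=> [e|t] [e'|t'] /=.
- by case: e; case: e' => // E; exfalso; lra.
- by have := h t'; case: e => ? E; exfalso; lra.
- by have := h t; case: e' => ? E; exfalso; lra.
- by move=> /hi->.
Qed.

Lemma length_node_inj (r : nat) : injective (@length_node r).
Proof.
have h (i : 'I_r.+1) : (i < reach r)%N by apply: leq_trans (ltn_ord i) _; rewrite /reach; lia.
move=> [[]|i] [[]|i'] //= /eqP; rewrite eqr_nat => /eqP e.
- by have := h i'; rewrite -e ltnn.
- by have := h i; rewrite e ltnn.
- by congr inr; apply: val_inj.
Qed.

(** The divided difference at the r+2 nodes 0, ..., r and [reach r] vanishes and is solved for the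
    value at [reach r]. *)
Lemma length_extrapolation (r : nat) (p : {poly R}) : (size p <= r.+1)%N ->
  \sum_(i < r.+1) length_coef i * p.[i%:R] = p.[(reach r)%:R].
Proof.
move=> sp; have := @divided_difference R _ (@length_node r) p (@length_node_inj r).
rewrite card_sum card_unit card_ord add1n ltnS => /(_ sp).
rewrite big_sumType /= (big_pred1 tt) => [|[] //].
rewrite -/(dd_weight _ _) => E.
have w0 := dd_weight_neq0 (inl tt) (@length_node_inj r).
apply: (mulIf w0); apply/eqP; rewrite -subr_eq0 -oppr_eq0; apply/eqP.
rewrite -[RHS]E mulr_suml opprB; congr (_ + _).
rewrite -sumrN; apply: eq_bigr => i _.
by rewrite /length_coef -/(dd_weight _ _) mulNr mulNr opprK mulrAC divfK // mulrC.
Qed.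

Lemma width_balance (r : nat) (p : {poly R}) : (0 < r)%N -> (size p <= r.+1)%N ->
  \sum_v width_coef v * p.[@width_node r v] = 0.
Proof.
move=> r0 sp; have := @divided_difference R _ (@width_node r) p (width_node_inj r0).
rewrite card_sum card_bool card_ord add2n ltnS => /(_ sp) E.
transitivity ((\sum_v p.[@width_node r v] * dd_weight (@width_node r) v) /
  dd_weight (@width_node r) (inl false)); last by rewrite /dd_weight E mul0r.
by rewrite mulr_suml; apply: eq_bigr => v _; rewrite /width_coef mulrC mulrA.
Qed.

(** The coefficient is the Lagrange weight, the product of (reach r - j) / (i - j) over j != i: the
    numerator is at most (reach r)^r and the denominator is i! (r - i)! in absolute value. *)
Lemma length_coef_bound (r : nat) (i : 'I_r.+1) : `|length_coef i| <= (2 ^ (7 * r))%:R.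
Proof.
have iM (j : 'I_r.+1) : (j < reach r)%N by apply: leq_trans (ltn_ord j) _; rewrite /reach; lia.
have iM0 (j : 'I_r.+1) : (reach r)%:R - j%:R != 0 :> R.
  by rewrite subr_eq0 eqr_nat neq_ltn iM orbT.
have -> : length_coef i = \prod_(j | j != i) ((reach r)%:R - j%:R) / \prod_(j | j != i) (i%:R - j%:R).
  have E1 : \prod_(v | v != inr i) (@length_node r (inr i) - @length_node r v) =
      (i%:R - (reach r)%:R) * \prod_(j | j != i) (i%:R - j%:R).
    by rewrite big_sumType /= (big_pred1 tt) => [|[] //].
  have E2 : \prod_(v | v != inl tt) (@length_node r (inl tt) - @length_node r v) =
      ((reach r)%:R - i%:R) * \prod_(j | j != i) ((reach r)%:R - j%:R).
    by rewrite big_sumType /= big_pred0 => [|[] //]; rewrite mul1r (bigD1 i).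
  have q0 : \prod_(j < r.+1 | j != i) (i%:R - j%:R) != 0 :> R.
    apply/prodf_neq0 => j ji; rewrite subr_eq0 eqr_nat eq_sym.
    by apply: contra ji => /eqP/val_inj->.
  rewrite /length_coef /dd_weight E1 E2 invr_div_invr -[i%:R - _]opprB mulNr invrN mulrN opprK.
  by rewrite -mulf_div divff ?mul1r.
have den : `|\prod_(j < r.+1 | j != i) (i%:R - j%:R)| = (i`! * (r - i)`!)%:R :> R.
  have ir : (i <= r)%N by rewrite -ltnS.
  rewrite -(prod_dist_fact ir) big_mkord natr_prod normr_prod; apply: eq_big => // j _.
  by case: ltnP => h; [rewrite ger0_norm ?subr_ge0 ?ler_nat ?natrB // ltnW |
    rewrite distrC ger0_norm ?subr_ge0 ?ler_nat ?natrB].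
rewrite normrM normfV den ler_pdivrMr ?ltr0n ?muln_gt0 ?fact_gt0 //.
have ir : (i <= r)%N by rewrite -ltnS.
rewrite -natrM; apply: le_trans (_ : ((reach r) ^ r)%:R <= _); last first.
  by rewrite ler_nat; exact: pow_le_fact.
rewrite normr_prod natrX.
have -> : (reach r)%:R ^+ r = \prod_(j < r.+1 | j != i) (reach r)%:R :> R.
  rewrite prodr_const; congr (_ ^+ _).
  have := cardC1 i; rewrite card_ord => /esym /= h; rewrite [LHS]h; apply: eq_card => j.
  by rewrite !inE.
apply: ler_prod => j _; rewrite normr_ge0 /= ger0_norm ?subr_ge0 ?ler_nat ?(ltnW (iM j)) //.
by rewrite lerBlDr ler_wpDr // ler0n.
Qed.

(** The heavy widths double from one to the next, so two of them differ by at least half of either.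
    This bounds the ratios in the coefficients of the heavy widths by 2. *)
Lemma heavy_width_dist (r : nat) (t j : 'I_r) : j != t ->
  `|1 - (heavy_width r j)%:R| <= 2 * `|(heavy_width r t)%:R - (heavy_width r j)%:R| :> R.
Proof.
move=> jt; set Y := (2 ^ (20 * r))%N.
have Y1 : (1 <= Y)%N by rewrite expn_gt0.
have dbl (a b : nat) : (a < b)%N -> (2 * heavy_width r a <= heavy_width r b)%N.
  move=> ab; rewrite /heavy_width mulnCA -expnS leq_mul2l leq_exp2l //.
  by rewrite ab orbT.
have pos (a : nat) : (1 <= heavy_width r a)%N by rewrite muln_gt0 !expn_gt0.
have p := pos j; rewrite -(ler_nat R) in p.
rewrite distrC ger0_norm ?subr_ge0 //.
case: (ltngtP t j) => [lt|lt|/val_inj e]; last by rewrite e eqxx in jt.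
  have := dbl _ _ lt; rewrite -(ler_nat R) natrM => h.
  have := pos t; rewrite -(ler_nat R) => p'.
  by rewrite distrC ger0_norm; lra.
have := dbl _ _ lt; rewrite -(ler_nat R) natrM => h.
by rewrite ger0_norm; lra.
Qed.

(** The coefficient is minus the product of (y - 1) / (y - 2) over the heavy widths y, with every
    factor at least 1. Its sign puts the filling by atoms of width 2 in the negative part. *)
Lemma width_coef_two_le (r : nat) : (0 < r)%N -> @width_coef r (inl true) <= -1.
Proof.
move=> r0.
have h (t : 'I_r) : 4 <= (heavy_width r t)%:R :> R by rewrite (ler_nat _ 4) heavy_width_ge.
have E1 : \prod_(v | v != inl true) (@width_node r (inl true) - @width_node r v) =
    \prod_(t < r) (2 - (heavy_width r t)%:R).
  by rewrite big_sumType /= (big_pred1 false) => [|[] //]; rewrite /= (_ : 2 - 1 = 1 :> R) ?mul1r //; lra.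
have E2 : \prod_(v | v != inl false) (@width_node r (inl false) - @width_node r v) =
    - \prod_(t < r) (1 - (heavy_width r t)%:R).
  rewrite big_sumType /= (big_pred1 true) => [|[] //]; rewrite /=.
  by rewrite (_ : 1 - 2 = -1 :> R) ?mulN1r //; lra.
rewrite /width_coef /dd_weight E1 E2 invr_div_invr mulNr lerN2 -prodf_div.
elim/big_ind: _ => // [x y hx hy|t _]; first by rewrite -[1]mulr1 ler_pM.
have := h t => ht; rewrite -[X in X / _]opprB -[X in _ / X]opprB invrN mulrNN.
by rewrite ler_pdivlMr; lra.
Qed.

(** After cancelling y t - 1, the coefficient is a product of ratios of size at most 2, divided by y
    t - 2, which is at least X / 2. *)
Lemma width_coef_heavy_bound (r : nat) (t : 'I_r) : (0 < r)%N ->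
  `|width_coef (inr t)| <= 2 * (2 ^ r)%:R / (2 ^ (20 * r))%:R.
Proof.
move=> r0.
have h (j : 'I_r) : 4 <= (heavy_width r j)%:R :> R by rewrite (ler_nat _ 4) heavy_width_ge.
pose y (j : 'I_r) : R := (heavy_width r j)%:R.
have E1 : \prod_(v | v != inr t) (@width_node r (inr t) - @width_node r v) =
    (y t - 2) * (y t - 1) * \prod_(j | j != t) (y t - y j).
  by rewrite big_sumType /= big_bool.
have E2 : \prod_(v | v != inl false) (@width_node r (inl false) - @width_node r v) =
    - ((1 - y t) * \prod_(j | j != t) (1 - y j)).
  rewrite big_sumType /= (big_pred1 true) => [|[] //]; rewrite /=.
  have -> : 1 - 2 = -1 :> R by lra.
  by rewrite mulN1r (bigD1 t).
have ht := h t.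
have q0 : \prod_(j | j != t) (y t - y j) != 0.
  apply/prodf_neq0 => j jt; have := heavy_width_dist jt; rewrite -/(y j) -/(y t) => H.
  apply: contraTneq H => ->; rewrite normr0 mulr0 -ltNge normr_gt0.
  by have := h j; rewrite -/(y j); lra.
have -> : width_coef (inr t) = (\prod_(j | j != t) ((1 - y j) / (y t - y j))) / (y t - 2).
  rewrite /width_coef /dd_weight E1 E2 invr_div_invr prodf_div; field.
  by rewrite q0 /=; apply/andP; split; apply/eqP; rewrite -/(y t) in ht; lra.
rewrite normrM normfV normr_prod [`|y t - 2|]ger0_norm; last by rewrite -/(y t) in ht; lra.
have yX : (2 ^ (20 * r))%:R <= y t.
  by rewrite ler_nat /heavy_width leq_pmulr // expn_gt0.
have X0 : 0 < (2 ^ (20 * r))%:R :> R by rewrite ltr0n expn_gt0.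
have top : \prod_(j | j != t) `|(1 - y j) / (y t - y j)| <= (2 ^ r)%:R.
  apply: (@le_trans _ _ (\prod_(j < r | j != t) 2)).
    apply: ler_prod => j jt; rewrite normr_ge0 /= normrM normfV.
    have d0 : y t - y j != 0 by move: q0 => /prodf_neq0 /(_ j jt).
    by rewrite ler_pdivrMr ?normr_gt0 //; exact: heavy_width_dist.
  rewrite prodr_const natrX ler_weXn2l ?ler1n //.
  by rewrite -[X in (_ <= X)%N]card_ord max_card.
rewrite ler_pdivrMr; last by rewrite -/(y t) in ht; lra.
apply: le_trans top _.
rewrite [leRHS](_ : _ = (2 ^ r)%:R * (2 * (y t - 2) / (2 ^ (20 * r))%:R)); last by ring.
rewrite ler_peMr ?ler0n // ler_pdivlMr // mul1r.
by rewrite -/(y t) in ht; lra.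
Qed.

(** * Fillings with matching moments *)

(* [inl false] and [inl true] fill the block with atoms of width 1 and 2, and
   [inr (t, i)] fills i units of length [base_unit r] at its end with atoms of
   width 2^t X. *)
Definition block_kind (r : nat) : finType := (bool + 'I_r * 'I_r.+1)%type.

Definition kind_units (r : nat) (k : block_kind r) : nat :=
  match k with inl _ => 0 | inr (_, i) => (reach r - i) * base_unit r end.
Definition kind_atoms (r : nat) (k : block_kind r) : nat :=
  match k with
  | inl false => reach r * base_unit r
  | inl true => 8 * r.+1 * base_unit r
  | inr (t, i) => i * 2 ^ (r - t)
  end.
Definition kind_width (r : nat) (k : block_kind r) : nat :=
  match k with inl e => if e then 2 else 1 | inr (t, _) => heavy_width r t end.

Lemma kind_width_gt0 (r : nat) (k : block_kind r) : (0 < kind_width k)%N.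
Proof. by case: k => [[]|[t i]] //=; rewrite muln_gt0 !expn_gt0. Qed.

Lemma pow_split (r : nat) (t : 'I_r) : (2 ^ (r - t) * heavy_width r t = base_unit r)%N.
Proof. by rewrite mulnCA -expnD subnK // ltnW. Qed.

Lemma reach_gt (r : nat) (i : 'I_r.+1) : (i <= reach r)%N.
Proof. by have := ltn_ord i; rewrite /reach; lia. Qed.

Lemma kind_total (r : nat) (k : block_kind r) :
  (kind_units k + kind_atoms k * kind_width k = reach r * base_unit r)%N.
Proof.
case: k => [[]|[t i]] /=; rewrite ?muln1 ?add0n //.
  by rewrite mulnAC /reach; congr (_ * _)%N; lia.
by rewrite -mulnA pow_split -mulnDl subnK // reach_gt.
Qed.

Definition block_gadget (r : nat) : gadget (reach r * base_unit r) :=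
  Gadget (@kind_width_gt0 r) (@kind_total r).

(* The divided difference weight of the filling by atoms of width 2^t X is spread
   over the kinds [inr (t, i)] by extrapolating from the lengths i to [reach r]. *)
Definition signed_weight (r : nat) (k : block_kind r) : R :=
  match k with
  | inl e => @width_coef r (inl e)
  | inr (t, i) => (width_coef (inr t) * length_coef i)%R
  end.

(** A block of mass D holds n = D / x atoms of width x, and x^c P(D / x) is a polynomial in x
    because P has degree at most c. *)
Lemma scaled_poly (c D : nat) (P : {poly R}) : (size P <= c.+1)%N ->
  exists2 g : {poly R}, (size g <= c.+1)%N &
    forall x n : nat, (n * x = D)%N -> g.[x%:R] = x%:R ^+ c * P.[n%:R].
Proof.
move=> sP; exists (\sum_(j < c.+1) (P`_j * D%:R ^+ j) *: 'X^(c - j)).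
  apply: leq_trans (size_sum _ _ _) _; apply/bigmax_leqP => j _.
  by apply: leq_trans (size_scale_leq _ _) _; rewrite size_polyXn ltnS leq_subr.
move=> x n <-; rewrite horner_sum (horner_coef_wide _ sP) big_distrr /=.
apply: eq_bigr => j _; rewrite hornerZ hornerXn natrM exprMn.
have -> : x%:R ^+ c = x%:R ^+ (c - j) * x%:R ^+ j :> R by rewrite -exprD subnK // -ltnS.
ring.
Qed.

Lemma size_comp_linear (P q : {poly R}) (n : nat) :
  (size P <= n.+1)%N -> (size q <= 2)%N -> (size (P \Po q) <= n.+1)%N.
Proof.
move=> sP sq; apply: leq_trans (size_comp_poly_leq _ _) _; rewrite ltnS.
have h1 : ((size P).-1 <= n)%N by lia.
have h2 : ((size q).-1 <= 1)%N by lia.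
by have := leq_mul h1 h2; rewrite muln1.
Qed.

Lemma signed_moment (r c0 c1 l0 l1 : nat) : (0 < r)%N ->
  (l0 <= c0)%N -> (l1 <= c1)%N -> (c0 + c1 <= r)%N ->
  \sum_k @signed_weight r k * (@block_moment _ (block_gadget r) c1 l0 l1 k)%:R = 0.
Proof.
move=> r0 h0 h1 hc.
set D := (reach r * base_unit r)%N.
have [P0 s0 E0] := bin_poly l0; have [P1 s1 E1] := bin_poly l1.
have [g sg Eg] := @scaled_poly c1 D P1 (leq_trans s1 (h1 : (l1 < c1.+1)%N)).
(* In the length i the moment is a polynomial of degree at most l0 + l1. Its extrapolation to
   [reach r] is the moment of a block without unit part, filled by atoms of width 2^t X, which is a
   polynomial in the width and so cancels by [width_balance]. *)
have tE (t : 'I_r) : \sum_(i < r.+1) length_coef i *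
    (@block_moment _ (block_gadget r) c1 l0 l1 (inr (t, i)))%:R =
    ('C(0, l0))%:R * g.[(heavy_width r t)%:R].
  pose e := (2 ^ (r - t))%N.
  pose p : {poly R} := ((heavy_width r t)%:R ^+ c1) *:
    ((P0 \Po (D%:R%:P - (base_unit r)%:R *: 'X)) * (P1 \Po (e%:R *: 'X))).
  have pE (u : nat) : (u <= reach r)%N -> p.[u%:R] = (heavy_width r t ^ c1 *
      'C((reach r - u) * base_unit r, l0) * 'C(u * e, l1))%:R.
    move=> hu; rewrite /p hornerZ hornerM !horner_comp hornerD hornerN !hornerZ hornerC hornerX.
    rewrite (natrM _ (_ * _)) (natrM _ (_ ^ _)) (natrX _ (heavy_width r t)) E0 E1 mulrA.
    rewrite mulnBl natrB ?leq_mul2r ?hu ?orbT // (natrM _ u (base_unit r)) (natrM _ u e).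
    by rewrite [u%:R * _]mulrC [u%:R * _]mulrC.
  have sp : (size p <= r.+1)%N.
    apply: leq_trans (size_scale_leq _ _) _; apply: leq_trans (size_polyMleq _ _) _.
    have b1 : (size (P0 \Po (D%:R%:P - (base_unit r)%:R *: 'X)) <= l0.+1)%N.
      apply: size_comp_linear => //; apply: leq_trans (size_polyD _ _) _.
      rewrite geq_max size_polyN (leq_trans (size_polyC_leq1 _)) //.
      by rewrite (leq_trans (size_scale_leq _ _)) ?size_polyX.
    have b2 : (size (P1 \Po (e%:R *: 'X)) <= l1.+1)%N.
      by apply: size_comp_linear => //; rewrite (leq_trans (size_scale_leq _ _)) ?size_polyX.
    by move: b1 b2; set n1 := size _; set n2 := size _; lia.
  rewrite (eq_bigr (fun i : 'I_r.+1 => length_coef i * p.[i%:R])) => [|i _].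
    rewrite length_extrapolation // pE // subnn mul0n (Eg _ (reach r * e)%N); last first.
      by rewrite -mulnA pow_split.
    rewrite (natrM _ (_ * _)) (natrM _ (_ ^ _)) (natrX _ (heavy_width r t)) (E1 (reach r * e)%N).
    by rewrite mulrAC mulrC.
  by rewrite pE ?reach_gt.
have eE e : (@block_moment _ (block_gadget r) c1 l0 l1 (inl e))%:R =
    ('C(0, l0))%:R * g.[@width_node r (inl e)].
  have -> : @width_node r (inl e) = (@kind_width r (inl e))%:R by case: e.
  rewrite (Eg _ (@kind_atoms r (inl e))); last by have := @kind_total r (inl e).
  by rewrite /block_moment !natrM natrX E1 /=; case: e; ring.
rewrite big_sumType /= (eq_bigr (fun e => ('C(0, l0))%:R *
  (@width_coef r (inl e) * g.[@width_node r (inl e)]))) => [|e _]; last by rewrite eE; ring.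
rewrite (eq_bigr (fun p : 'I_r * 'I_r.+1 => width_coef (inr p.1) * (length_coef p.2 *
    (@block_moment _ (block_gadget r) c1 l0 l1 (inr (p.1, p.2)))%:R))) => [|[t i] _]; last first.
  by rewrite /=; ring.
rewrite -(pair_bigA _ (fun t i => width_coef (inr t) * (length_coef i *
    (@block_moment _ (block_gadget r) c1 l0 l1 (inr (t, i)))%:R))) /=.
rewrite [X in _ + X](eq_bigr (fun t => ('C(0, l0))%:R *
  (width_coef (inr t) * g.[@width_node r (inr t)]))) => [|t _]; last by rewrite -big_distrr /= tE; ring.
have sr : (size g <= r.+1)%N by apply: leq_trans sg _; rewrite ltnS; lia.
have := width_balance r0 sr; rewrite big_sumType /= => wb.
by rewrite -!big_distrr -mulrDr /= wb mulr0.
Qed.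

(** Each of the r (r + 1) <= 2^(2r) terms is at most 2 * 2^(8r) / 2^(20r), so the sum is at most 2 /
    2^(10r) <= 2 / 1024. *)
Lemma signed_weight_tail (r : nat) : (0 < r)%N ->
  \sum_(p : 'I_r * 'I_r.+1) `|@signed_weight r (inr p)| <= 100%:R^-1.
Proof.
move=> r0; pose A : R := (2 * (2 ^ r)%:R / (2 ^ (20 * r))%:R * (2 ^ (7 * r))%:R)%R.
apply: (@le_trans _ _ (\sum_(p : 'I_r * 'I_r.+1) A)).
  apply: ler_sum => -[t i] _ /=; rewrite normrM ler_pM ?normr_ge0 //.
    exact: width_coef_heavy_bound.
  exact: length_coef_bound.
rewrite sumr_const card_prod !card_ord -[leLHS]mulr_natr /A.
have X0 : 0 < (2 ^ (20 * r))%:R :> R by rewrite ltr0n expn_gt0.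
rewrite [leLHS](_ : _ = (2 * 2 ^ r * 2 ^ (7 * r) * (r * r.+1))%:R / (2 ^ (20 * r))%:R); last first.
  rewrite (natrM _ (_ * _)) (natrM _ (2 * _)) (natrM _ 2).
  by move: (_ ^-1) (r * _)%:R (2 ^ r)%:R (2 ^ (7 * r))%:R => x n a b; ring.
rewrite ler_pdivrMr // mulrC ler_pdivlMr ?ltr0n // -natrM ler_nat mulnC.
have a1 : (r <= 2 ^ r)%N by apply: ltnW; apply: ltn_expl.
have a2 : (r.+1 <= 2 ^ r)%N by apply: ltn_expl.
have -> : (20 * r = r + 7 * r + (r + r) + (10 * r))%N by lia.
rewrite (expnD 2 (r + 7 * r + (r + r))) (expnD 2 (r + 7 * r)) (expnD 2 r (7 * r)) (expnD 2 r r).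
have a3 : (2 ^ 10 <= 2 ^ (10 * r))%N by rewrite leq_exp2l //; lia.
have a4 := leq_mul a1 a2.
have a5 := leq_mul a3 (leq_mul (leqnn (2 ^ r * 2 ^ (7 * r))%N) a4).
have e10 : (2 ^ 10 = 1024)%N by [].
rewrite e10 in a5; move: a5.
by move: (2 ^ r)%N (2 ^ (7 * r))%N (2 ^ (10 * r))%N (r * r.+1)%N => a b c q; lia.
Qed.

Lemma gadget_exists (r : nat) : (0 < r)%N ->
  exists (D s : nat) (g : gadget D) (pi pi' : kind g -> R),
    [/\ (0 < s)%N, (16 * s <= D)%N & (D <= 2 ^ (26 * r))%N] /\
    [/\ prob_on pi, prob_on pi' & moments_match r pi pi'] /\
    (forall k, pi k != 0 -> yes_kind s k) /\
    \sum_(k | ~~ far_kind k) pi' k <= 100%:R^-1.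
Proof.
move=> r0; set lam := @signed_weight r.
have lam0 : lam (inl false) = 1.
  by rewrite /lam /= /width_coef divff // dd_weight_neq0 //; exact: width_node_inj.
have [|//|W [W1 [h1 h2]]] := @signed_split (block_kind r) lam.
- rewrite -[RHS](@signed_moment r 0 0 0 0 r0) //; apply: eq_bigr => k _.
  by rewrite /block_moment expn0 !bin0 mulr1.
- by exists (inl false); rewrite lam0.
have W0 : 0 < W by apply: lt_le_trans W1.
(* s is the largest mass that wide atoms take up in the mixed fillings, namely r base units. *)
exists (reach r * base_unit r)%N, (r * base_unit r)%N, (block_gadget r).
exists (fun k => Num.max (lam k) 0 / W), (fun k => Num.max (- lam k) 0 / W).
split; [split|split; [split|split]] => //.
- by rewrite muln_gt0 r0 /base_unit muln_gt0 !expn_gt0.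
- by rewrite mulnA leq_mul2r /reach; apply/orP; right; lia.
- rewrite /reach /base_unit.
  (* 16 (r + 1) <= 2^(5r), and [base_unit r] is 2^(21r). *)
  have -> : (26 * r = (4 * r + r) + (20 * r + r))%N by lia.
  rewrite (expnD 2 (4 * r + r)) (expnD 2 (4 * r)) (expnD 2 (20 * r)) leq_mul2r; apply/orP; right.
  by apply: leq_mul; [rewrite -[16%N]/(2 ^ 4)%N leq_exp2l //; lia | apply: ltn_expl].
- move=> c0 c1 l0 l1 hl0 hl1 hc; apply/eqP; rewrite -subr_eq0 -sumrB; apply/eqP.
  rewrite (eq_bigr (fun k => W^-1 * (lam k * (@block_moment _ (block_gadget r) c1 l0 l1 k)%:R))).
    by rewrite -big_distrr /= (signed_moment r0 hl0 hl1 hc) mulr0.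
  by move=> k _; rewrite -mulrBl -mulrBl maxB_opp; ring.
(* Only the filling by atoms of width 2 is not a yes kind, and its weight is negative; the mixed
   fillings are yes kinds whatever their sign. *)
- move=> [[]|[t i]]; rewrite /yes_kind //= => nz.
    case/eqP: nz; rewrite (_ : Num.max _ _ = 0) ?mul0r //; apply/max_idPr.
    by have := width_coef_two_le r0; rewrite /lam /=; lra.
  by rewrite -mulnBl leq_mul2r leq_sub2l ?orbT // -ltnS.
(* The filling by atoms of width 1 has weight 1, hence mass 0 in the negative part; what remains is
   the tail. *)
rewrite big_sumType /= big1 ?add0r; last first.
  move=> [] // _; rewrite -[width_coef _]/(lam (inl false)) lam0.
  rewrite (_ : Num.max _ _ = 0) ?mul0r //; apply/max_idPr.
  by lra.
apply: le_trans (signed_weight_tail r0); rewrite big_mkcond; apply: ler_sum => p _.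
case: ifP => _ //; rewrite -[X in Num.max (- X) _]/(lam (inr p)) ler_pdivrMr //.
apply: (@le_trans _ _ `|lam (inr p)|).
  by rewrite ge_max normr_ge0 andbT -normrN ler_norm.
by rewrite ler_peMr.
Qed.

(** * Distributions in P_q *)

Definition prefix_sum (n : nat) (p : 'I_n -> R) (i : nat) : R := (\sum_(l < n | (l < i)%N) p l)%R.

Lemma prefix_sum0 (n : nat) (p : 'I_n -> R) : prefix_sum p 0 = 0.
Proof. by rewrite /prefix_sum big1. Qed.

Lemma prefix_sum_full (n : nat) (p : 'I_n -> R) : is_dist p -> prefix_sum p n = 1.
Proof. by case=> _ <-; apply: eq_bigl => i; rewrite ltn_ord. Qed.

Lemma prefix_sum_split (n : nat) (p : 'I_n -> R) (a b : nat) : (a <= b)%N ->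
  prefix_sum p b = prefix_sum p a + \sum_(i < n | (a <= i < b)%N) p i.
Proof.
move=> ab; rewrite /prefix_sum (bigID (fun i : 'I_n => (i < a)%N)) /=; congr (_ + _).
  by apply: eq_bigl => i; lia.
by apply: eq_bigl => i; rewrite -leqNgt andbC.
Qed.

Lemma prefix_sumS (n : nat) (p : 'I_n -> R) (j : 'I_n) :
  prefix_sum p j.+1 = prefix_sum p j + p j.
Proof.
rewrite (prefix_sum_split p (leqnSn j)); congr (_ + _).
by rewrite (big_pred1 j) // => i /=; rewrite ltnS -eqn_leq eq_sym.
Qed.

Lemma le_prefix_sum (n : nat) (p : 'I_n -> R) (a b : nat) : is_dist p -> (a <= b)%N ->
  prefix_sum p a <= prefix_sum p b.
Proof.
by case=> p0 _ ab; rewrite (prefix_sum_split p ab) ler_wpDr // sumr_ge0.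
Qed.

(** The boundary b j is the first index at which the prefix sums of p reach that of q at j, which
    makes b monotone with b 0 = 0. *)
Lemma in_Pq_of_prefix (n k : nat) (q : 'I_k -> R) (p : 'I_n -> R) :
  is_dist p -> is_dist q -> (0 < k)%N ->
  (forall j, (j < k)%N -> exists2 i, (i <= n)%N & prefix_sum p i = prefix_sum q j) ->
  in_Pq q p.
Proof.
move=> hp hq k0 H; split=> //.
pose first j := find (fun i => prefix_sum q j <= prefix_sum p i) (iota 0 n.+1).
have firstP j i : (i <= n)%N -> prefix_sum q j <= prefix_sum p i -> (first j <= i)%N.
  move=> hi le; rewrite leqNgt; apply/negP => lt.
  by have := before_find 0%N lt; rewrite nth_iota // add0n le.
have first_n j : (j <= k)%N -> (first j <= n)%N.
  move=> jk; apply: firstP => //.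
  by rewrite (prefix_sum_full hp) -(prefix_sum_full hq) le_prefix_sum.
have firstE j : (j < k)%N -> prefix_sum p (first j) = prefix_sum q j.
  move=> jk; have [i hi e] := H j jk; apply/eqP; rewrite eq_le; apply/andP; split.
    by rewrite -e le_prefix_sum // firstP // e.
  have hj := first_n j (ltnW jk).
  have hs : has (fun i => prefix_sum q j <= prefix_sum p i) (iota 0 n.+1).
    by rewrite has_find size_iota ltnS.
  by have := nth_find 0%N hs; rewrite -/(first j) nth_iota.
(* The last boundary has to be n even if p vanishes on the last labels. *)
pose b j := if (j < k)%N then first j else n.
have bE j : (j <= k)%N -> prefix_sum p (b j) = prefix_sum q j.
  rewrite /b leq_eqVlt => /predU1P[->|jk]; last by rewrite jk firstE.
  by rewrite ltnn !prefix_sum_full.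
have b_mono j : (j < k)%N -> (b j <= b j.+1)%N.
  move=> jk; rewrite /b jk; case: ifP => _; last by rewrite first_n // ltnW.
  by apply: sub_find => i; apply: le_trans; rewrite le_prefix_sum.
exists b; split.
  split; last by split=> //; rewrite /b ltnn.
  by apply/eqP; rewrite -leqn0 /b k0 firstP // !prefix_sum0.
move=> j; have := prefix_sum_split p (b_mono j (ltn_ord j)).
have jk := ltnW (ltn_ord j); by rewrite (bE _ (ltn_ord j)) (bE _ jk) prefix_sumS => /addrI ->.
Qed.

(** The bins come in B groups of D - s + 1, one group per block; the bins after them are empty,
    which allows any k that is large enough. *)
Definition bin_units (B D s j : nat) : nat :=
  if (j < B * (D - s).+1)%N then (if (j %% (D - s).+1 < D - s)%N then 1 else s) else 0.

Definition bin_dist (k B D s : nat) (j : 'I_k) : R :=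
  ((bin_units B D s j)%:R / (B * D)%:R)%R.

Definition bin_start (B D s j : nat) : nat :=
  if (j < B * (D - s).+1)%N then (j %/ (D - s).+1 * D + j %% (D - s).+1)%N else (B * D)%N.

Lemma bin_startS (B D s j : nat) : (s <= D)%N ->
  bin_start B D s j.+1 = (bin_start B D s j + bin_units B D s j)%N.
Proof.
move=> sD; rewrite /bin_start /bin_units; set K := (D - s).+1.
case: (ltnP j) => h1; last by rewrite ifF ?addn0 //; lia.
have Ej := divn_eq j K; set a := (j %/ K)%N in Ej *; set c := (j %% K)%N in Ej *.
have cK : (c < K)%N by rewrite ltn_mod.
have aB : (a < B)%N by rewrite ltn_divLR.
case: (ltnP c (D - s)) => hc.
  have hc' : (c.+1 < K)%N by rewrite ltnS.
  have -> : (j.+1 = a * K + c.+1)%N by rewrite {1}Ej addnS.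
  rewrite divnMDl // modnMDl divn_small // modn_small // addn0 ifT; first lia.
  by apply: leq_trans (leq_mul aB (leqnn K)); rewrite mulSn addnC ltn_add2r.
have c_eq : c = (D - s)%N by apply/eqP; rewrite eqn_leq hc andbT -ltnS.
have -> : (j.+1 = a.+1 * K)%N by rewrite mulSn {1}Ej c_eq /K; lia.
rewrite mulnK // modnMl addn0 ltn_pmul2r // c_eq.
case: (ltnP a.+1 B) => h2; first by rewrite mulSn; lia.
have -> : B = a.+1 by apply/eqP; rewrite eqn_leq h2 aB.
by rewrite mulSn; lia.
Qed.

Lemma prefix_bin_dist (k B D s j : nat) : (s <= D)%N -> (0 < B)%N -> (j <= k)%N ->
  prefix_sum (@bin_dist k B D s) j = (bin_start B D s j)%:R / (B * D)%:R.
Proof.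
move=> sD B0; elim: j => [|j IH] jk.
  by rewrite prefix_sum0 /bin_start muln_gt0 B0 /= div0n mod0n mul0n add0n mul0r.
by rewrite (prefix_sumS _ (Ordinal jk)) /= (IH (ltnW jk)) bin_startS // natrD mulrDl.
Qed.

Lemma bin_dist_is_dist (k B D s : nat) : (s <= D)%N -> (0 < B)%N -> (0 < D)%N ->
  (B * (D - s).+1 <= k)%N -> is_dist (@bin_dist k B D s).
Proof.
move=> sD B0 D0 hk; split; first by move=> j; rewrite divr_ge0 ?ler0n.
have <- : prefix_sum (@bin_dist k B D s) k = \sum_(j < k) bin_dist B D s j.
  by apply: eq_bigl => j; rewrite ltn_ord.
rewrite prefix_bin_dist // /bin_start ltnNge hk /= divff //.
by rewrite pnatr_eq0 muln_eq0 negb_or -!lt0n B0.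
Qed.

Definition label_monotone (P n : nat) (z : nat -> 'I_n) : Prop :=
  forall a b, (a < b < P)%N -> (z a < z b)%N.

Lemma label_monotone_lt (P n : nat) (z : nat -> 'I_n) (a b : nat) :
  label_monotone P z -> (a < P)%N -> (b < P)%N -> (z a < z b)%N = (a < b)%N.
Proof.
move=> hz aP bP; case: (ltngtP a b) => [lt|gt|->]; last by rewrite ltnn.
  by rewrite hz // lt bP.
by apply/negbTE; rewrite -leqNgt ltnW // hz // gt aP.
Qed.

Lemma label_dist_is_dist (D : nat) (g : gadget D) (B n : nat) (z : nat -> 'I_n)
    (tau : {ffun 'I_B -> kind g}) : (0 < D)%N -> (0 < B)%N -> is_dist (label_dist z tau).
Proof.
move=> D0 B0; split; first by move=> i; apply: sumr_ge0 => j _; exact: slot_weight_ge0.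
rewrite -(total_slot_weight tau D0 B0) [RHS](partition_big (fun j => z (slot_code j)) predT) //=.
Qed.

Lemma prefix_label_dist (D : nat) (g : gadget D) (B n : nat) (z : nat -> 'I_n)
    (tau : {ffun 'I_B -> kind g}) (j0 : slot B D) :
  label_monotone (B.*2 * D) z ->
  prefix_sum (label_dist z tau) (z (slot_code j0)) =
  \sum_(j : slot B D | (slot_code j < slot_code j0)%N) slot_weight tau j.
Proof.
move=> hz; rewrite /prefix_sum /label_dist (exchange_big_dep predT) //= [RHS]big_mkcond.
apply: eq_bigr => j _; rewrite -(label_monotone_lt hz) ?slot_code_lt //.
case: ifP => h.
  rewrite (big_pred1 (z (slot_code j))) // => i /=.
  by rewrite [i == _]eq_sym; case: eqP => [<-|_]; rewrite ?h ?andbF.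
by rewrite big_pred0 // => i; case: eqP => [<-|_]; rewrite ?h ?andbF.
Qed.

Lemma sum_ord_lt_inv (B b : nat) : (b < B)%N ->
  \sum_(b' < B) (if (b' < b)%N then B%:R^-1 else 0) = b%:R / B%:R :> R.
Proof. by move=> h; rewrite sum_ord_lt ?(ltnW h) // mulrC. Qed.

Lemma prefix_yes (D : nat) (g : gadget D) (B n s a : nat) (z : nat -> 'I_n)
    (tau : {ffun 'I_B -> kind g}) (b : 'I_B) :
  (0 < s <= D)%N -> label_monotone (B.*2 * D) z -> yes_kind s (tau b) -> (a <= D - s)%N ->
  exists i : nat, (i <= n)%N /\
    prefix_sum (label_dist z tau) i = (b * D + a)%:R / (B * D)%:R.
Proof.
move=> /andP[s0 sD] hz hk ha.
have D0 : (0 < D)%N by apply: leq_trans s0 sD.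
have B0 : (0 < B)%N by apply: leq_ltn_trans (ltn_ord b).
have aD : (a < D)%N by apply: leq_ltn_trans ha _; rewrite ltn_subrL s0.
(* [e] selects the zone whose atoms fill the first D - s units of block b: the wide zone only if the
   unit zone has too few. [j0] is slot a of this zone, possibly of weight 0, and the slots below it
   carry b blocks and a units. *)
pose e := (units (tau b) < D - s)%N.
pose j0 : slot B D := ((b, e), Ordinal aD).
exists (z (slot_code j0)); split; first by apply: ltnW.
rewrite prefix_label_dist // big_mkcond sum_slot.
have Eb : \sum_e' \sum_t (if (slot_code ((b, e'), t) < slot_code j0)%N
    then slot_weight tau ((b, e'), t) else 0) = a%:R / (B * D)%:R.
  pose th : R := ((B * D)%:R^-1)%R.
  have Et : \sum_(t < D) (if (t < a)%N then th else 0) = a%:R / (B * D)%:R.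
    by rewrite sum_ord_lt ?(ltnW aD) // mulrC.
  have code_same e' (t : 'I_D) : e' = e -> (slot_code ((b, e'), t) < slot_code j0)%N = (t < a)%N.
    by move=> ->; rewrite /slot_code /= ltn_add2l.
  have [he|he] := boolP e; last first.
    have hu : (D - s <= units (tau b))%N by rewrite leqNgt.
    rewrite big_bool /= big1 ?add0r => [|t _]; last first.
      rewrite ifF //; apply/negbTE; rewrite -leqNgt ltnW //.
      by apply: slot_code_lt_zone; rewrite /= (negbTE he) /=; lia.
    rewrite -Et; apply: eq_bigr => t _; rewrite code_same ?(negbTE he) //.
    case: ifP => // ta; rewrite /slot_weight /zone_atoms /zone_width /= ifT ?mul1r //.
    by apply: leq_trans ta _; apply: leq_trans ha hu.
  have /andP[/eqP u0 /eqP w1] : (units (tau b) == 0%N) && (width (tau b) == 1%N).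
    by move: hk; rewrite /yes_kind leqNgt -/e he orbF.
  have at_D : atoms (tau b) = D by have := total_mass (tau b); rewrite u0 w1 muln1.
  rewrite big_bool /= [X in _ + X]big1 ?addr0 => [|t _]; last first.
    by rewrite /slot_weight /zone_atoms /= u0 /=; case: ifP.
  rewrite -Et; apply: eq_bigr => t _; rewrite code_same ?he //.
  by case: ifP => // ta; rewrite /slot_weight /zone_atoms /zone_width /= at_D w1 ltn_ord mul1r.
rewrite (bigD1 b) //= Eb natrD mulrDl addrC; congr (_ + _).
have -> : (b * D)%:R / (B * D)%:R = b%:R / B%:R :> R.
  by rewrite !natrM -mulf_div divff ?mulr1 // pnatr_eq0 -lt0n.
rewrite -(sum_ord_lt_inv (ltn_ord b)) [RHS](bigD1 b) //= ltnn add0r.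
apply: eq_bigr => b' ne; case: (ltngtP b' b) => [lt|gt|/val_inj e']; last by rewrite e' eqxx in ne.
  rewrite -(block_weight tau b' D0); apply: eq_bigr => e' _; apply: eq_bigr => t _.
  by rewrite ifT //; apply: slot_code_lt_zone => /=; case: e' => /=; case: (e) => /=; lia.
apply: big1 => e' _; apply: big1 => t _; rewrite ifF //; apply/negbTE; rewrite -leqNgt ltnW //.
by apply: slot_code_lt_zone => /=; case: e' => /=; case: (e) => /=; lia.
Qed.

Lemma label_dist_in_Pq (D : nat) (g : gadget D) (B n k s : nat) (z : nat -> 'I_n)
    (tau : {ffun 'I_B -> kind g}) :
  (0 < s <= D)%N -> (0 < B)%N -> (B * (D - s).+1 <= k)%N ->
  label_monotone (B.*2 * D) z -> (forall b, yes_kind s (tau b)) ->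
  in_Pq (@bin_dist k B D s) (label_dist z tau).
Proof.
move=> hs B0 hk hz hyes; have /andP[s0 sD] := hs.
have D0 : (0 < D)%N by apply: leq_trans s0 sD.
have hp := label_dist_is_dist z tau D0 B0.
apply: in_Pq_of_prefix => //; first exact: bin_dist_is_dist.
  by apply: leq_trans hk; rewrite muln_gt0 B0.
move=> j jk; rewrite prefix_bin_dist ?(ltnW jk) // /bin_start.
case: ltnP => hj; last first.
  exists n => //; rewrite prefix_sum_full // divff //.
  by rewrite pnatr_eq0 muln_eq0 negb_or -!lt0n B0.
have hb : (j %/ (D - s).+1 < B)%N by rewrite ltn_divLR.
have ha : (j %% (D - s).+1 <= D - s)%N by rewrite -ltnS ltn_mod.
by have [i [hi E]] := prefix_yes hs hz (hyes (Ordinal hb)) ha; exists i.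
Qed.

(** * Distributions far from P_q *)

Lemma interval_partition_cover (n k : nat) (b : nat -> nat) (i : nat) :
  interval_partition n k b -> (i < n)%N -> exists j : 'I_k, (b j <= i < b j.+1)%N.
Proof.
case=> b0 [bk _] hi.
have ex : exists j, (i < b j)%N by exists k; rewrite bk.
case: (ex_minnP ex) => -[|j] hj hmin; first by rewrite b0 in hj.
have jk : (j < k)%N by apply: hmin; rewrite bk.
exists (Ordinal jk) => /=; rewrite hj andbT leqNgt; apply/negP => lt.
by have := hmin _ lt; rewrite ltnn.
Qed.

Lemma le_sum_image (I J : finType) (h : J -> I) (P : pred J) (G : I -> R) :
  injective h -> (forall i, 0 <= G i) -> \sum_(j | P j) G (h j) <= \sum_i G i.
Proof.
move=> hinj G0; rewrite (partition_big h predT) //=; apply: ler_sum => i _.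
have [j /andP[Pj /eqP e]|none] := pickP (fun j => P j && (h j == i)); last by rewrite big_pred0.
rewrite (big_pred1 j) ?e // => j' /=; apply/andP/eqP => [[_ /eqP e']|->].
  by apply: hinj; rewrite e'.
by rewrite Pj e.
Qed.

Lemma bin_dist_large (k B D s : nat) : (0 < D)%N -> (0 < B)%N ->
  \sum_(j < k | ((B * D)%:R^-1 < @bin_dist k B D s j)) bin_dist B D s j <= s%:R / D%:R.
Proof.
move=> D0 B0; set K := (D - s).+1; set th : R := ((B * D)%:R^-1)%R.
have th0 : 0 < th by rewrite invr_gt0 ltr0n muln_gt0 B0.
(* The positions of the bins of s units, at most one per block. If s = 1 they do not exceed [th], so
   only one implication holds below. *)
pose large (j : 'I_k) := (j < B * K)%N && (j %% K == D - s)%N.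
have large_of j : th < @bin_dist k B D s j -> large j.
  rewrite /bin_dist /bin_units /large -/K; case: ifP => _; last by rewrite mul0r ltNge (ltW th0).
  case: ltnP => h; first by rewrite mul1r ltxx.
  by move=> _; rewrite eqn_leq h andbT -ltnS ltn_mod.
have large_le j : @bin_dist k B D s j <= if large j then s%:R * th else th.
  rewrite /bin_dist /bin_units /large -/K; case: ifP => _ /=; last by rewrite mul0r ltW.
  case: ltnP => h; first by rewrite (ltn_eqF h) mul1r.
  by rewrite eqn_leq h andbT -ltnS ltn_mod.
have card_large : (#|[set j | large j]| <= B)%N.
  rewrite -[X in (_ <= X)%N](size_iota 0) cardE -(size_map (fun j : 'I_k => (j %/ K)%N)).
  apply: uniq_leq_size.
    rewrite map_inj_in_uniq ?enum_uniq // => i j; rewrite !mem_enum !inE.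
    move=> /andP[_ /eqP e1] /andP[_ /eqP e2] e; apply: val_inj => /=.
    by rewrite (divn_eq i K) (divn_eq j K) e e1 e2.
  move=> x /mapP[j]; rewrite mem_enum inE => /andP[lt _] ->.
  by rewrite mem_iota /= add0n ltn_divLR.
apply: (@le_trans _ _ (\sum_(j | large j) (s%:R * th))).
  rewrite [leLHS]big_mkcond [leRHS]big_mkcond; apply: ler_sum => j _.
  case: ifP => [/large_of lj|_]; first by have := large_le j; rewrite lj.
  by case: ifP => // _; rewrite mulr_ge0 ?ler0n // ltW.
rewrite sumr_const -[leLHS]mulr_natl.
have -> : s%:R / D%:R = B%:R * (s%:R * th) :> R.
  rewrite /th natrM invfM mulrCA [_ * (_^-1 / _)]mulrA divff ?mul1r //.
  by rewrite pnatr_eq0 -lt0n.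
rewrite ler_wpM2r ?mulr_ge0 ?ler0n ?(ltW th0) // ler_nat.
by apply: leq_trans card_large; rewrite cardsE.
Qed.

Lemma label_slot_inj (B D n : nat) (z : nat -> 'I_n) :
  label_monotone (B.*2 * D) z -> injective (fun j : slot B D => z (slot_code j)).
Proof.
move=> hz j j' e; apply: slot_code_inj.
have h1 := label_monotone_lt hz (slot_code_lt j) (slot_code_lt j').
have h2 := label_monotone_lt hz (slot_code_lt j') (slot_code_lt j).
rewrite e ltnn in h1 h2.
by case: (ltngtP (slot_code j) (slot_code j')) h1 h2.
Qed.

Lemma label_dist_slot (D : nat) (g : gadget D) (B n : nat) (z : nat -> 'I_n)
    (tau : {ffun 'I_B -> kind g}) (j : slot B D) :
  label_monotone (B.*2 * D) z -> label_dist z tau (z (slot_code j)) = slot_weight tau j.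
Proof.
move=> hz; rewrite /label_dist (big_pred1 j) // => j' /=.
by apply: (inj_eq (label_slot_inj hz)).
Qed.

(** At least 7/8 of the blocks consist of atoms of mass 2 th. Outside of the large bins p' gives a
    label at most th, and the large bins carry at most 1/16, so the L1 distance is at least 7/16 -
    1/16, and half of it exceeds 1/10. *)
Lemma label_dist_far (D : nat) (g : gadget D) (B n k s : nat) (z : nat -> 'I_n)
    (tau : {ffun 'I_B -> kind g}) :
  (0 < s)%N -> (16 * s <= D)%N -> (0 < B)%N -> label_monotone (B.*2 * D) z ->
  (8 * #|[set b | ~~ far_kind (tau b)]| <= B)%N ->
  far_from_Pq (@bin_dist k B D s) 10%:R^-1 (label_dist z tau).
Proof.
move=> s0 sD B0 hz hcard p' [[p'0 _] [b [hb hbins]]].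
have D0 : (0 < D)%N by lia.
set p := label_dist z tau; set th : R := ((B * D)%:R^-1)%R.
have th0 : 0 < th by rewrite invr_gt0 ltr0n muln_gt0 B0.
pose large (j : 'I_k) := th < @bin_dist k B D s j.
(* This is p' i on the large bins and 0 elsewhere; summing over j avoids choosing the bin of i. *)
pose flex (i : 'I_n) := \sum_(j < k | large j && (b j <= i < b j.+1)%N) p' i.
have flex0 i : 0 <= flex i by apply: sumr_ge0.
have sum_flex : \sum_i flex i <= 16%:R^-1.
  rewrite /flex (exchange_big_dep large) /=; last by move=> i j _ /andP[].
  rewrite (eq_bigr (fun j => bin_dist B D s j)) => [|j lj]; last first.
    by rewrite -hbins; apply: eq_bigl => i; rewrite lj.
  apply: le_trans (bin_dist_large k s D0 B0) _.
  by rewrite ler_pdivrMr ?ltr0n // mulrC ler_pdivlMr // -natrM ler_nat mulnC.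
pose far (j : slot B D) := [&& far_kind (tau j.1.1), j.1.2 & (j.2 < atoms (tau j.1.1))%N].
(* For every label, |p - p'| + flex is nonnegative; on an atom of mass 2 th it is at
   least th, since outside of the large bins p' does not exceed th. *)
pose G i := `|p i - p' i| + flex i.
have G_far j : far j -> th <= G (z (slot_code j)).
  case/and3P => /andP[_ /eqP w2] e at_j.
  have pj : p (z (slot_code j)) = 2 * th.
    by rewrite /p label_dist_slot // /slot_weight /zone_atoms /zone_width e at_j w2.
  set i := z (slot_code j) in pj *; rewrite /G pj.
  have [jb jbP] := interval_partition_cover hb (ltn_ord i).
  have := ler_norm (2 * th - p' i).
  have [lj|nlj] := boolP (large jb).
    have : p' i <= flex i by rewrite /flex (bigD1 jb) ?lj //= ler_wpDr // sumr_ge0.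
    by lra.
  have : p' i <= bin_dist B D s jb by rewrite -hbins (bigD1 i) //= ler_wpDr // sumr_ge0.
  rewrite /large -leNgt in nlj; have := flex0 i; lra.
have sum_far : 7%:R / 16%:R <= \sum_(j | far j) th.
  rewrite big_mkcond sum_slot.
  (* A far block has D / 2 atoms, which contribute (D / 2) th = 1 / (2 B). *)
  apply: (@le_trans _ _ (\sum_(b0 < B) if far_kind (tau b0) then (2 * B%:R)^-1 else 0)).
    rewrite -big_mkcond sumr_const -[leRHS]mulr_natr [leRHS]mulrC.
    have := cardsC [set b0 | ~~ far_kind (tau b0)]; rewrite card_ord.
    rewrite [X in (_ + X)%N](_ : _ = #|[pred b0 | far_kind (tau b0)]|); last first.
      by apply: eq_card => b0; rewrite !inE negbK.
    set c := #|[set _ | _]| in hcard *; set d := #|_| => cd.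
    have BR : 0 < B%:R :> R by rewrite ltr0n.
    rewrite ler_pdivlMr ?mulr_gt0 // mulrAC ler_pdivrMr // -!natrM ler_nat.
    lia.
  apply: ler_sum => b0 _; rewrite big_bool /= [X in _ + X]big1 ?addr0; last first.
    by move=> t _; rewrite /far /= andbF.
  rewrite /far /=; case: ifP => hf; last by rewrite sumr_ge0 // => t _; rewrite ltW.
  rewrite sum_ord_lt ?atoms_le //.
  have /andP[/eqP u0 /eqP w2] := hf; have := total_mass (tau b0); rewrite u0 w2 add0n => aD.
  have BR : B%:R != 0 :> R by rewrite pnatr_eq0 -lt0n.
  have aR : (atoms (tau b0))%:R != 0 :> R by rewrite pnatr_eq0; apply/eqP => a0; rewrite a0 in aD; lia.
  rewrite le_eqVlt; apply/predU1P; left.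
  have DR : D%:R = (atoms (tau b0))%:R * 2 :> R by rewrite -natrM aD.
  rewrite /th natrM DR; field.
  by rewrite BR aR.
have H1 : \sum_(j | far j) th <= \sum_i G i.
  apply: (@le_trans _ _ (\sum_(j | far j) G (z (slot_code j)))); first exact: ler_sum.
  apply: (@le_sum_image _ _ (fun j => z (slot_code j)) far G); first exact: label_slot_inj hz.
  by move=> i; rewrite addr_ge0.
have H : \sum_(j | far j) th <= \sum_i `|p i - p' i| + \sum_i flex i by rewrite -big_split.
have -> : dTV p p' = 2^-1 * \sum_i `|p i - p' i| by [].
move: H sum_flex sum_far.
move: (\sum_i `|_|) (\sum_i flex i) (\sum_(j | far j) th) => S A X; lra.
Qed.

(** * The lower bound *)

Lemma expect_addr (B : nat) (K : finType) (pi : K -> R) (c : R) (X : {ffun 'I_B -> K} -> R) :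
  prob_on pi -> expect pi (fun tau => X tau + c) = expect pi X + c.
Proof.
move=> hp; rewrite -[in RHS](@expect_const B K pi c hp) /expect -big_split.
by apply: eq_bigr => tau _; rewrite mulrDr.
Qed.

Lemma expect_coord (B : nat) (K : finType) (pi : K -> R) (b : 'I_B) (P : pred K) :
  prob_on pi ->
  expect pi (fun tau : {ffun 'I_B -> K} => (P (tau b))%:R) = \sum_(k | P k) pi k.
Proof.
case=> _ p1; pose f (b' : 'I_B) k : R := if b' == b then (P k)%:R else 1.
rewrite (eq_expect _ (Y := fun tau : {ffun 'I_B -> K} => \prod_b' f b' (tau b'))); last first.
  by move=> tau; rewrite (bigD1 b) //= /f eqxx big1 ?mulr1 // => b' /negbTE->.
rewrite expect_prod (bigD1 b) //= [X in _ * X]big1 ?mulr1 => [|b' /negbTE ne].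
  by rewrite /f eqxx [RHS]big_mkcond; apply: eq_bigr => k _; case: (P k); rewrite ?mulr1 ?mulr0.
by rewrite /f ne -[RHS]p1; apply: eq_bigr => k _; rewrite mulr1.
Qed.

(** Markov's inequality for the number of blocks satisfying P. *)
Lemma expect_many_bad (B : nat) (K : finType) (pi : K -> R) (P : pred K) (d : R) :
  (0 < B)%N -> prob_on pi -> \sum_(k | P k) pi k <= d ->
  expect pi (fun tau : {ffun 'I_B -> K} => (B < 8 * #|[set b | P (tau b)]|)%N%:R) <= 8 * d.
Proof.
move=> B0 hp hd; have BR : 0 < B%:R :> R by rewrite ltr0n.
apply: (@le_trans _ _ (expect pi (fun tau : {ffun 'I_B -> K} =>
    8 / B%:R * \sum_b (P (tau b))%:R))).
  apply: le_expect => // tau _.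
  have -> : \sum_b (P (tau b))%:R = #|[set b | P (tau b)]|%:R :> R.
    by rewrite -sum1_card natr_sum [RHS]big_mkcond; apply: eq_bigr => b _; rewrite inE; case: (P (tau b)).
  case: ltnP => h; last by rewrite mulr_ge0 ?divr_ge0 ?ler0n.
  by rewrite mulrAC ler_pdivlMr // mul1r -natrM ler_nat ltnW.
rewrite expect_scale expect_sum (eq_bigr (fun=> \sum_(k | P k) pi k)) => [|b _]; last first.
  exact: expect_coord.
rewrite sumr_const card_ord -[X in _ * X]mulr_natr mulrC -mulrA [_ * (8 / _)]mulrCA divff ?gt_eqF //.
by rewrite mulr1 mulrC ler_wpM2l.
Qed.

Lemma acc_order_close (D : nat) (g : gadget D) (B n m : nat) (z : nat -> 'I_n)
    (F : ('I_m -> nat) -> R) (T : m.-tuple 'I_n -> R) (e : R) (tau : {ffun 'I_B -> kind g}) :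
  (0 < D)%N -> (0 < B)%N ->
  (forall w : 'I_m -> nat, (forall i, (w i < B.*2 * D)%N) ->
    `|T [tuple z (w i) | i < m] - F w| <= e) ->
  `|acc_prob (label_dist z tau) T - order_acc F tau| <= e.
Proof.
move=> D0 B0 close; rewrite (acc_prob_pushforward _ (fun j => z (slot_code j))) -sumrB.
apply: le_trans (ler_norm_sum _ _ _) _.
apply: (@le_trans _ _ (\sum_(w : {ffun 'I_m -> slot B D}) (\prod_i slot_weight tau (w i)) * e)).
  apply: ler_sum => w _; rewrite -mulrBr normrM ger0_norm; last first.
    by apply: prodr_ge0 => i _; exact: slot_weight_ge0.
  apply: ler_wpM2l; first by apply: prodr_ge0 => i _; exact: slot_weight_ge0.
  by apply: close => i; exact: slot_code_lt.
rewrite -big_distrl /= (sum_prod_ffun (F := fun _ j => slot_weight tau j) (a := fun=> 1)) => [|i].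
  by rewrite big1 // mul1r.
exact: total_slot_weight.
Qed.

Lemma acc_prob_le1 (n m : nat) (p : 'I_n -> R) (T : m.-tuple 'I_n -> R) :
  is_dist p -> (forall x, 0 <= T x <= 1) -> acc_prob p T <= 1.
Proof.
case=> p0 p1 T01; apply: (@le_trans _ _ (\sum_(x : m.-tuple 'I_n) \prod_(i < m) p (tnth x i))).
  apply: ler_sum => x _; have /andP[_ T1] := T01 x.
  by apply: ler_piMr => //; apply: prodr_ge0.
have := acc_prob_pushforward p id (fun _ : m.-tuple 'I_n => 1).
rewrite /acc_prob => E.
rewrite le_eqVlt; apply/predU1P; left.
transitivity (\sum_(x : m.-tuple 'I_n) \prod_(i < m) (\sum_(j | j == tnth x i) p j) * 1).
  by apply: eq_bigr => x _; rewrite mulr1; apply: eq_bigr => i _; rewrite big_pred1_eq.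
rewrite E (eq_bigr (fun w : {ffun 'I_m -> 'I_n} => \prod_i p (w i))) => [|w _]; last by rewrite mulr1.
by rewrite (sum_prod_ffun (F := fun _ j => p j) (a := fun=> 1)) // big1.
Qed.

(** The acceptance probability averages at least 2/3 under pi, and under pi' at most 1/3 plus 8/100
    for the event that more than B / 8 blocks are not far. Passing to F costs 1/100 on each side and
    crowded samples 1/100, too little to close the gap. *)
Lemma no_tester (D s r B k n m : nat) (g : gadget D) (pi pi' : kind g -> R)
    (z : nat -> 'I_n) (F : ('I_m -> nat) -> R) (T : m.-tuple 'I_n -> R) :
  (0 < s)%N -> (16 * s <= D)%N -> (0 < B)%N -> (B * (D - s).+1 <= k)%N ->
  prob_on pi -> prob_on pi' -> moments_match r pi pi' ->
  (forall kd, pi kd != 0 -> yes_kind s kd) ->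
  \sum_(kd | ~~ far_kind kd) pi' kd <= 100%:R^-1 ->
  (100 * 'C(m, r.+1) <= B ^ r)%N ->
  label_monotone (B.*2 * D) z -> (forall w, 0 <= F w <= 1) -> order_invariant F ->
  (forall w : 'I_m -> nat, (forall i, (w i < B.*2 * D)%N) ->
    `|T [tuple z (w i) | i < m] - F w| <= 100%:R^-1) ->
  ~ solves_BinIdentity (@bin_dist k B D s) 10%:R^-1 T.
Proof.
move=> s0 sD B0 hk hp hp' mm hyes hfar hm hz F01 Finv close [T01 hT].
have D0 : (0 < D)%N by lia.
have hs : (0 < s <= D)%N by rewrite s0; lia.
pose acc (tau : {ffun 'I_B -> kind g}) := acc_prob (label_dist z tau) T.
have near (tau : {ffun 'I_B -> kind g}) : `|acc tau - order_acc F tau| <= 100%:R^-1.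
  exact: acc_order_close.
have yes : 2%:R / 3%:R <= expect pi acc.
  rewrite -[leLHS](@expect_const B _ pi _ hp); apply: le_expect => // tau nz.
  apply: (hT _ (label_dist_is_dist z tau D0 B0)).1.
  by apply: label_dist_in_Pq => // b; apply: hyes.
have no : expect pi' acc <= 8 * 100%:R^-1 + 1 / 3%:R.
  apply: (@le_trans _ _ (expect pi' (fun tau : {ffun 'I_B -> kind g} =>
      (B < 8 * #|[set b | ~~ far_kind (tau b)]|)%N%:R) + 1 / 3%:R)); last first.
    by rewrite lerD2r; apply: (@expect_many_bad B _ pi' (fun kd => ~~ far_kind kd)).
  rewrite -(expect_addr _ _ hp'); apply: le_expect => // tau _.
  have hd := label_dist_is_dist z tau D0 B0.
  case: ltnP => h; first by apply: le_trans (acc_prob_le1 hd T01) _; rewrite lerDl divr_ge0 ?ler0n.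
  rewrite add0r; apply: (hT _ hd).2; exact: label_dist_far.
have up : expect pi acc <= expect pi (fun tau : {ffun 'I_B -> kind g} => order_acc F tau) + 100%:R^-1.
  rewrite -(expect_addr _ _ hp); apply: le_expect => // tau _.
  by have := le_trans (ler_norm _) (near tau); lra.
have down : expect pi' (fun tau : {ffun 'I_B -> kind g} => order_acc F tau) <= expect pi' acc + 100%:R^-1.
  rewrite -(expect_addr _ _ hp'); apply: le_expect => // tau _.
  by have := near tau; rewrite distrC => /(le_trans (ler_norm _)); lra.
have mid := expect_order_acc_close D0 B0 hp hp' Finv F01 mm.
have tail : ('C(m, r.+1))%:R / B%:R ^+ r <= 100%:R^-1 :> R.
  by rewrite -natrX ler_pdivrMr ?ltr0n ?expn_gt0 ?B0 // mulrC ler_pdivlMr // -natrM ler_nat mulnC.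
have gap := le_trans (le_trans (ler_norm _) mid) tail.
have absurd (a a' b b' : R) : 2%:R / 3%:R <= a -> a' <= 8 * 100%:R^-1 + 1 / 3%:R ->
    a <= b + 100%:R^-1 -> b' <= a' + 100%:R^-1 -> b - b' <= 100%:R^-1 -> False by lra.
exact: absurd yes no up down gap.
Qed.

(** 2^(r^2) <= k amounts to r <= sqrt (log k). *)
Lemma Rpower_sqrt_log2_ge (C r k : nat) : (2 ^ (r * r) <= k)%N ->
  (2 ^ (C * r))%:R <= Rpower 2%R (C%:R * sqrt (log2 k%:R)).
Proof.
move=> hk; have twoE : 2%R = IZR 2 :> R by rewrite -INRE.
have k_ge : Rle (pow (IZR 2) (r * r)) (INR k).
  by apply/RleP; rewrite RpowE INRE -twoE -natrX ler_nat.
have k_gt0 : Rlt R0 (INR k) by apply: Rlt_le_trans k_ge; apply: pow_lt; exact: Rlt_0_2.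
have ln2 : Rlt R0 (ln (IZR 2)) by apply: Rlt_trans ln_lt_2; apply: Rinv_0_lt_compat; exact: Rlt_0_2.
have lt12 : Rlt R1 (IZR 2) by exact: (IZR_lt 1 2).
apply/RleP; rewrite natrX -RpowE twoE -!INRE.
have l_ge : Rle (INR (r * r)) (log2 (INR k)).
  apply: Rnot_lt_le => lt.
  have /(Rle_lt_trans _ _ _ k_ge) : Rlt (INR k) (pow (IZR 2) (r * r)).
    rewrite -Rpower_pow; last exact: Rlt_0_2.
    have {1}<- : Rpower (IZR 2) (log2 (INR k)) = INR k.
      rewrite /Rpower /log2 twoE /Rdiv Rmult_assoc Rinv_l ?Rmult_1_r ?exp_ln //.
      exact: Rgt_not_eq.
    exact: Rpower_lt.
  exact: Rlt_irrefl.
have s_ge : Rle (INR r) (sqrt (log2 (INR k))).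
  rewrite -(sqrt_square (INR r)); last exact: pos_INR.
  by apply: sqrt_le_1_alt; rewrite -mult_INR.
rewrite -Rpower_pow; last exact: Rlt_0_2.
apply: Rle_Rpower; first exact: Rlt_le.
rewrite mult_INR; apply: Rmult_le_compat_l => //; exact: pos_INR.
Qed.

Lemma square_log_bracket (k : nat) : (0 < k)%N ->
  exists r, (2 ^ (r * r) <= k < 2 ^ (r.+1 * r.+1))%N.
Proof.
move=> k0.
have ex : exists r, (k < 2 ^ (r.+1 * r.+1))%N.
  exists k; apply: (@ltn_trans (2 ^ k)); first exact: ltn_expl.
  by rewrite ltn_exp2l //; lia.
case: (ex_minnP ex) => r hr hmin; exists r; rewrite hr andbT.
case: r hr hmin => [|r] hr hmin; first by rewrite mul0n expn0.
by rewrite leqNgt; apply/negP => /hmin; rewrite ltnn.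
Qed.

Lemma square_log_large (r0 : nat) :
  exists k0, forall k r, (k0 <= k)%N -> (k < 2 ^ (r.+1 * r.+1))%N -> (r0 <= r)%N.
Proof.
exists (2 ^ (r0 * r0))%N => k r h1 h2; have := leq_ltn_trans h1 h2.
by rewrite ltn_exp2l //; nia.
Qed.

(** The number of labels is fixed before the tester, so one threshold has to serve all sample sizes
    up to a bound. *)
Lemma bounded_threshold (Q : nat -> nat -> Prop) :
  (forall m, exists N, forall n, (N <= n)%N -> Q m n) ->
  forall M, exists N, forall m n, (m <= M)%N -> (N <= n)%N -> Q m n.
Proof.
move=> H; elim=> [|M [N IH]].
  by have [N HN] := H 0%N; exists N => m n; rewrite leqn0 => /eqP->; exact: HN.
have [N' HN'] := H M.+1; exists (N + N')%N => m n; rewrite leq_eqVlt ltnS.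
by case/predU1P => [-> h|mM h]; [apply: HN'; lia | apply: IH => //; lia].
Qed.

Lemma bin_le_exp (m j : nat) : ('C(m, j) <= m ^ j)%N.
Proof.
apply: (@leq_trans (m ^_ j)); first by rewrite -bin_ffact leq_pmulr // fact_gt0.
rewrite ffact_prod -[X in (_ ^ X)%N]card_ord -prod_nat_const.
by apply: leq_prod => i _; exact: leq_subr.
Qed.

(** From k <= 2 B 2^(26r) and k < 2^((r+1)^2) follows k^(r+1) <= (2 B 2^(26r))^r 2^((r+1)^2). The
    powers of 2 on the right are absorbed by (2^(31r))^(r+1), as (26r + 1) r + (r + 1)^2 <= 31 r (r
    + 1). *)
Lemma few_samples (r k K m : nat) :
  (27 <= r)%N -> (2 ^ (r * r) <= k < 2 ^ (r.+1 * r.+1))%N -> (0 < K <= 2 ^ (26 * r))%N ->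
  (100 * m * 2 ^ (31 * r) <= k)%N ->
  (0 < k %/ K)%N /\ (100 * 'C(m, r.+1) <= (k %/ K) ^ r)%N.
Proof.
move=> hr /andP[k1 k2] /andP[K0 K1] hm; set B := (k %/ K)%N.
(* As r >= 27, 2^(26r) <= 2^(r^2) <= k. *)
have Kk : (K <= k)%N.
  by apply: leq_trans K1 (leq_trans _ k1); rewrite leq_exp2l // leq_mul2r; lia.
have B0 : (0 < B)%N by rewrite divn_gt0.
split=> //.
have kB : (k <= B * 2 ^ (26 * r).+1)%N.
  have h1 : (k < B.+1 * K)%N by exact: ltn_ceil.
  have h2 : (B.+1 * K <= B.*2 * 2 ^ (26 * r))%N by apply: leq_mul => //; lia.
  apply: ltnW; apply: leq_trans h1 (leq_trans h2 _).
  by rewrite expnS mulnA muln2.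
have main : ((100 * m * 2 ^ (31 * r)) ^ r.+1 <= (B * 2 ^ (26 * r).+1) ^ r * 2 ^ (r.+1 * r.+1))%N.
  apply: leq_trans (_ : k ^ r.+1 <= _)%N; first by rewrite leq_exp2r.
  by rewrite expnSr; apply: leq_mul; [rewrite leq_exp2r //; lia | exact: ltnW].
rewrite !expnMn -!expnM in main.
have e1 : (2 ^ ((26 * r).+1 * r) * 2 ^ (r.+1 * r.+1) <= 2 ^ (31 * r * r.+1))%N.
  by rewrite -expnD leq_exp2l //; nia.
have {}main : (100 ^ r.+1 * m ^ r.+1 <= B ^ r)%N.
  have p0 : (0 < 2 ^ (31 * r * r.+1))%N by rewrite expn_gt0.
  rewrite -(leq_pmul2r p0); apply: leq_trans main _.
  by rewrite -mulnA leq_mul2l e1 orbT.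
apply: leq_trans main; apply: leq_mul; last exact: bin_le_exp.
by rewrite -{1}[100%N]expn1 leq_exp2l.
Qed.

Theorem theorem4 :
  exists eps0 : R, 0 < eps0 /\
  exists C : R, 0 < C /\ exists c : R, 0 < c /\ exists k0 : nat,
  forall k : nat, (1 <= k)%N -> (k0 <= k)%N ->
    exists (n : nat) (q : 'I_k -> R), is_dist q /\
      forall (m : nat) (T : m.-tuple 'I_n -> R),
        solves_BinIdentity q eps0 T ->
        c * k%:R / Rpower 2%R (C * sqrt (log2 k%:R)) <= m%:R.
Proof.
exists (10%:R^-1); split; first by rewrite invr_gt0.
(* 31 and 1/100 come from the sample bound in [few_samples]. *)
exists (31%:R); split; first by rewrite ltr0n.
exists (100%:R^-1); split; first by rewrite invr_gt0 ltr0n.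
have [k0 hk0] := square_log_large 27; exists k0 => k k1 kk0.
have [r hr] := square_log_bracket k1.
have r27 : (27 <= r)%N by apply: hk0 kk0 _; case/andP: hr.
have [|D [s [g [pi [pi' [[s0 sD D1] [[hp hp' mm] [hyes hfar]]]]]]]] := @gadget_exists r; first by lia.
(* A block takes K bins, and as many blocks are used as fit into k bins. *)
pose K := (D - s).+1; pose B := (k %/ K)%N.
have K_le : (0 < K <= 2 ^ (26 * r))%N by rewrite /K; lia.
have BK : (B * K <= k)%N by exact: leq_trunc_div.
have B0 : (0 < B)%N by have [] := few_samples (m := 0) r27 hr K_le isT.
(* Rounding to multiples of 1 / (99 + 1) gives precision 1/100. Sample sizes up to k suffice, since
   a tester violating the bound has m <= k. *)
have [N HN] := bounded_threshold (fun m => order_invariant_tester m (B.*2 * D) 99) k.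
exists N.+1, (@bin_dist k B D s); split; first by apply: bin_dist_is_dist => //; lia.
move=> m T hT; rewrite leNgt; apply/negP => lt.
have hm : (100 * m * 2 ^ (31 * r) <= k)%N.
  have := @Rpower_sqrt_log2_ge 31 r k; case/andP: hr => -> _ /(_ isT).
  move: lt; set w := Rpower _ _ => lt hw.
  have w0 : 0 < w by apply: lt_le_trans hw; rewrite ltr0n expn_gt0.
  rewrite ltr_pdivlMr // [X in _ < X]mulrC ltr_pdivlMr ?ltr0n // in lt.
  rewrite -(ler_nat R) (natrM _ (100 * m)) (natrM _ 100); apply: le_trans (ltW lt).
  by rewrite -mulrA mulrC ler_wpM2r ?ler0n // ler_wpM2l ?ler0n.
have [_ few] := few_samples r27 hr K_le hm.
have mk : (m <= k)%N by apply: leq_trans hm; rewrite mulnAC leq_pmull // muln_gt0 expn_gt0.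
have [z [F [hz F01 Finv close]]] := HN m N mk (leqnn N) T hT.1.
exact: (no_tester s0 sD B0 BK hp hp' mm hyes hfar few hz F01 Finv close hT).
Qed.
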